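(* For every $d\in\mathbb{N}$ consider the random walk $S_k^{(d)}:=X_1^{(d)}+\dots+X_k^{(d)}$ in $\mathbb{R}^d$ with increments $X_i^{(d)}:=R_iU_i^{(d)}$, $i\in\mathbb{N}$, where $(R_i)_{i=1}^\infty$ are independent copies of a non-negative random variable $R$ (whose distribution does not depend on $d$) with $\mathbb{E}R^2=1$; $(U_i^{(d)})_{i=1}^\infty$ are i.i.d. random vectors uniformly distributed on the unit sphere in $\mathbb{R}^d$; and $(R_i)_{i=1}^\infty$ and $(U_i^{(d)})_{i=1}^\infty$ are independent. Suppose that $\mathbb{E}R^4<\infty$, and let $n=n(d)$ be a sequence of positive integers with $n(d)\to\infty$ as $d\to\infty$. (a) If $\lim_{d\to\infty}n/d=0$ and $R$ is not deterministic, then, as $d\to\infty$, $$\frac{\|S_n^{(d)}\|^2-n}{\sqrt n}\ \overset{w}{\longrightarrow}\ \mathrm{N}(0,\mathrm{Var}(R^2)).$$ (b) If $\lim_{d\to\infty}n/d=\infty$ or $R$ is deterministic, then, as $d\to\infty$, $$\frac{\|S_n^{(d)}\|^2-n}{\sqrt{2n^2/d}}\ \overset{w}{\longrightarrow}\ \mathrm{N}(0,1).$$ (c) If $n\sim\gamma d$ for some constant $\gamma\in(0,\infty)$, then, as $d\to\infty$, $$\frac{\|S_n^{(d)}\|^2-n}{\sqrt n}\ \overset{w}{\longrightarrow}\ \mathrm{N}(0,2\gamma+\mathrm{Var}(R^2)).$$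
   Context: $\|\cdot\|$ is the Euclidean norm, $\overset{w}{\longrightarrow}$ denotes convergence in distribution, $\mathrm{N}(0,\sigma^2)$ is the centered normal distribution with variance $\sigma^2$, ''deterministic'' means a.s. constant, and $n\sim\gamma d$ means $n/d\to\gamma$ as $d\to\infty$. *)

(* Defs.v *)
From HB Require Import structures.
From mathcomp Require Import all_boot all_order all_algebra finmap.
From mathcomp Require Import all_classical all_reals all_analysis.

Set Implicit Arguments.
Unset Strict Implicit.
Unset Printing Implicit Defensive.

Import Order.TTheory GRing.Theory Num.Theory.
Import numFieldNormedType.Exports.

Local Open Scope classical_set_scope.
Local Open Scope ring_scope.

(* Matrices, in particular the row vectors 'rV[K]_d standing for R^d, are
   equipped with the Borel sigma-algebra of their norm topology. *)
Section borel_matrix.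
Context (K : realType) (m n : nat).

Definition borel_mx : set (set 'M[K]_(m, n)) := <<s open >>.

Lemma borel_mx0 : borel_mx set0.
Proof. exact: sigma_algebra0. Qed.

Lemma borel_mxC A : borel_mx A -> borel_mx (~` A).
Proof. exact: sigma_algebraC. Qed.

Lemma borel_mx_bigcup (F : (set 'M[K]_(m, n))^nat) :
  (forall i, borel_mx (F i)) -> borel_mx (\bigcup_i F i).
Proof. exact: sigma_algebra_bigcup. Qed.

HB.instance Definition _ := @isMeasurable.Build default_measure_display
  'M[K]_(m, n) borel_mx borel_mx0 borel_mxC borel_mx_bigcup.

End borel_matrix.

(* The library norm on 'rV[K]_d is the sup norm. *)
Definition enorm (K : realType) (d : nat) (x : 'rV[K]_d) : K :=
  Num.sqrt (\sum_(i < d) x ord0 i ^+ 2).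

(* The uniform distribution on the unit sphere (normalized surface measure),
   introduced as the rotation-invariant probability measure carried by the
   sphere. It exists, and is unique, as soon as 0 < d; for d = 0 the sphere is
   empty and the predicate is never satisfied. *)
Definition uniform_on_sphere (K : realType) (d : nat)
    (mu : probability 'rV[K]_d K) :=
  mu [set x | enorm x = 1] = 1%E /\
  forall Q : 'M[K]_d, Q *m Q^T = 1%:M ->
  forall A : set 'rV[K]_d, measurable A -> mu ((mulmxr Q) @^-1` A) = mu A.

Section probability_notions.
Context disp (T : measurableType disp) (K : realType) (P : probability T K).

Definition independent_sets (I : choiceType) (F : I -> set (set T)) :=
  forall (J : {fset I}) (E : I -> set T), (forall i, i \in J -> F i (E i)) ->
  P (\bigcap_(i in [set` J]) E i) = (\prod_(i <- J) P (E i))%E.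

Definition independent_RVs disp' (T' : measurableType disp') (I : choiceType)
    (X : I -> {RV P >-> T'}) :=
  independent_sets (fun i => g_sigma_algebra_preimage (X i)).

Definition sigma_family disp' (T' : measurableType disp') (I : Type)
    (X : I -> {RV P >-> T'}) : set (set T) :=
  <<s \bigcup_i g_sigma_algebra_preimage (X i) >>.

Definition independent_families d1 (T1 : measurableType d1)
    d2 (T2 : measurableType d2) (I J : Type)
    (X : I -> {RV P >-> T1}) (Y : J -> {RV P >-> T2}) :=
  forall A B, sigma_family X A -> sigma_family Y B ->
  P (A `&` B) = (P A * P B)%E.

Definition same_law disp' (T' : measurableType disp')
    (X Y : {RV P >-> T'}) :=
  forall A, measurable A -> distribution P X A = distribution P Y A.

Definition deterministic (X : {RV P >-> K}) :=
  exists c : K, {ae P, forall w, X w = c}.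

Definition cvg_in_distribution (X : nat -> T -> K)
    (mu : probability (measurableTypeR K) K) :=
  forall f : K -> K, continuous f -> bounded_fun f ->
  ('E_P[f \o X d])%E @[d --> \oo] --> (\int[mu]_x (f x)%:E)%E.

(* S_k = X_1 + ... + X_k with X_i = R_i U_i; sequences are indexed from 0. *)
Definition walk (d : nat) (Rs : nat -> {RV P >-> K})
    (U : nat -> {RV P >-> 'rV[K]_d}) (k : nat) (w : T) : 'rV[K]_d :=
  \sum_(i < k) Rs i w *: U i w.

End probability_notions.

(* The library's normal_prob takes the standard deviation as its second
   argument, here sqrt v; used only for v > 0 (for standard deviation 0 the
   library value is a placeholder, not a Dirac mass). *)
Definition centered_normal (K : realType) (v : K) :
    probability (measurableTypeR K) K :=
  normal_prob 0 (Num.sqrt v).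

(* Main.v *)
Require Import Defs.
From HB Require Import structures.
From mathcomp Require Import all_boot all_order all_algebra finmap.
From mathcomp Require Import all_classical all_reals all_analysis.
From mathcomp Require Import ring lra.
Import measurable_realfun.

Set Implicit Arguments.
Unset Strict Implicit.
Unset Printing Implicit Defensive.

Import Order.TTheory GRing.Theory Num.Theory.
Import numFieldNormedType.Exports.

Local Open Scope classical_set_scope.
Local Open Scope ring_scope.

(* The squared norms N_k = |S_k|^2 form a Markov chain: by rotation invariance
   the law of N_{k+1} - N_k = R^2 + 2 R <S_k, U> given the past depends on N_k
   only, with conditional mean 1 and conditional variance V + 4 N_k / d, where
   V = Var (R^2). Hence Var N_n = n V + 2 n (n - 1) / d, and the three parts are
   one central limit theorem, for norming constants c_d such that
   (n V + 2 n^2 / d) / c_d^2 tends to some s2 > 0. It is proved by Lindeberg's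
   replacement argument, with translates of the heat kernel
   h(v, x) = exp (- x^2 / (2 v)) / sqrt v as test functions: since h solves
   h_v = h_xx / 2, each step of the chain is traded for an increase of v by its
   mean conditional variance, which leaves E h(tau, (N_n - n) / c_d - m) close
   to h(tau + Var N_n / c_d^2, - m), uniformly in m. A bounded continuous test
   function is reduced to this case by mollification with a Gaussian density of
   variance tau. *)

(** Two features shape the estimates. The conditional variance V + 4 N_k / d is random, so trading a
    step for a deterministic amount of heat costs a term linear in N_k - k; it is paid for by Var
    N_k, computed exactly beforehand. And E R^4 < oo gives the radial part R^2 - 1 of an increment a
    second moment only, so that part is truncated ([cut_cube]), whereas the spherical part 2 R <S_k,
    U> has a fourth moment of order N_k^2 / d^2, because E u_0^4 <= 3 / d^2. The summed error is
    expressed through quantities controlled by (n V + 2 n^2 / d) / c_d^2, so n and d are never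
    compared with each other and all regimes are covered at once. Uniformity in m is what allows
    integrating over m in the mollification; the test function is first cut off to a compact
    interval because Lebesgue measure is infinite. Conditioning is replaced by Tonelli's theorem:
    the fresh variable is integrated out against its own law, with the past held fixed. *)

(** * The heat kernel, its derivatives and Lindeberg's one-step estimate *)

Section heat_kernel.
Context {K : realType}.
Implicit Types (f g : K -> K) (a b h p t v w x y : K).

#[local] Instance is_derive_expR_comp f x a : is_derive x (1 : K) f a ->
  is_derive x (1 : K) (fun y => expR (f y)) (expR (f x) * a).
Proof. by move=> fa; exact: (is_derive1_comp (is_derive_expR _)). Qed.

(** Only points to the right of [a] enter, so this applies to the time variable, in which the kernel
    is differentiated at positive times only; [taylor1_ge] has the same form for the same reason. *)
Lemma mean_value_ge f (df : K -> K) a b : a <= b ->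
  (forall t, a <= t -> is_derive t (1 : K) f (df t)) ->
  exists2 c, a <= c <= b & f b - f a = df c * (b - a).
Proof.
move=> ab fdf; have [||c ci ->] := @MVT_segment _ f df a b ab.
- by move=> t; rewrite in_itv /= => /andP[/ltW at_ _]; exact: fdf.
- apply: derivable_within_continuous => t; rewrite in_itv /= => /andP[/fdf ? _].
  exact: ex_derive.
- by exists c; first by move: ci; rewrite in_itv.
Qed.

Lemma mean_value_increment f (df : K -> K) x h :
  (forall t, `|t| <= `|h| -> is_derive (x + t) (1 : K) f (df t)) ->
  exists2 t, `|t| <= `|h| & f (x + h) - f x = df t * h.
Proof.
move=> fdf.
have key t : `|t - x| <= `|h| -> is_derive t (1 : K) f (df (t - x)).
  by move=> th; have := fdf _ th; rewrite addrC subrK.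
have cf a b : (forall t, t \in `[a, b] -> `|t - x| <= `|h|) ->
    {within `[a, b], continuous f}.
  move=> ab; apply: derivable_within_continuous => t /ab /key ft.
  exact: ex_derive.
have [h0|h0] := leP 0 h.
  have xh : x <= x + h by rewrite lerDl.
  have ab t : t \in `[x, x + h] -> `|t - x| <= `|h|.
    by rewrite in_itv /= => /andP[? ?]; rewrite !ger0_norm//; lra.
  have [||c ci ->] := @MVT_segment _ f (fun t => df (t - x)) _ _ xh.
  - by move=> t ti; apply/key/ab; apply: subset_itv_oo_cc ti.
  - exact: cf ab.
  by exists (c - x); [exact: ab | congr (_ * _); ring].
have xh : x + h <= x by lra.
have ab t : t \in `[x + h, x] -> `|t - x| <= `|h|.
  by rewrite in_itv /= => /andP[? ?]; rewrite !ler0_norm//; lra.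
have [||c ci E] := @MVT_segment _ f (fun t => df (t - x)) _ _ xh.
- by move=> t ti; apply/key/ab; apply: subset_itv_oo_cc ti.
- exact: cf ab.
exists (c - x); first exact: ab.
by rewrite -opprB E; ring.
Qed.

(** Two successive mean values give the constant C instead of Taylor's C / 2, which is good enough
    here. *)
Lemma taylor1_bound f f1 f2 x h C :
  (forall t, `|t| <= `|h| -> is_derive (x + t) (1 : K) f (f1 (x + t))) ->
  (forall t, `|t| <= `|h| -> is_derive (x + t) (1 : K) f1 (f2 (x + t))) ->
  (forall t, `|t| <= `|h| -> `|f2 (x + t)| <= C) ->
  `|f (x + h) - f x - h * f1 x| <= C * h ^+ 2.
Proof.
move=> d1 d2 bd.
have [t th E] := mean_value_increment d1.
have [|s st E2] := @mean_value_increment f1 (fun t => f2 (x + t)) x t.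
  by move=> s st; apply: d2; exact: le_trans th.
have -> : f (x + h) - f x - h * f1 x = (f1 (x + t) - f1 x) * h.
  by rewrite E; ring.
have C0 : 0 <= C by apply: le_trans (bd s (le_trans st th)).
rewrite E2 !normrM -mulrA -(real_normK (num_real h)) expr2.
apply: ler_pM => //.
  by apply: bd; exact: le_trans th.
exact: ler_wpM2r.
Qed.

Lemma taylor1_ge f (f1 f2 : K -> K) a b C : a <= b ->
  (forall t, a <= t -> is_derive t (1 : K) f (f1 t)) ->
  (forall t, a <= t -> is_derive t (1 : K) f1 (f2 t)) ->
  (forall t, a <= t -> `|f2 t| <= C) ->
  `|f b - f a - (b - a) * f1 a| <= C * (b - a) ^+ 2.
Proof.
move=> ab d1 d2 bd.
have [c /andP[ac cb] E1] := mean_value_ge ab d1.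
have [d /andP[ad dc] E2] := mean_value_ge ac d2.
rewrite E1 mulrC -mulrBr E2 mulrCA normrM; apply: ler_pM => //; first exact: bd.
rewrite expr2 ger0_norm; last by apply: mulr_ge0; lra.
by apply: ler_pM => //; lra.
Qed.

Lemma taylor2_bound f f1 f2 f3 x h C :
  (forall t, is_derive t (1 : K) f (f1 t)) ->
  (forall t, is_derive t (1 : K) f1 (f2 t)) ->
  (forall t, is_derive t (1 : K) f2 (f3 t)) ->
  (forall t, `|f3 t| <= C) ->
  `|f (x + h) - f x - h * f1 x - h ^+ 2 / 2 * f2 x| <= C * `|h| ^+ 3.
Proof.
move=> d1 d2 d3 bd.
(* The derivative of [g] is the first-order remainder of [f1] at x, so one mean value for [g]
   followed by [taylor1_bound] for [f1] gives the cubic bound. *)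
pose g t := f t - (t - x) * f1 x - (t - x) ^+ 2 / 2 * f2 x.
have dg t : is_derive t (1 : K) g (f1 t - f1 x - (t - x) * f2 x).
  by apply: is_derive_eq; rewrite /GRing.scale /=; field.
have [t th E] := @mean_value_increment g
  (fun t => f1 (x + t) - f1 x - (x + t - x) * f2 x) x h (fun t _ => dg (x + t)).
have -> : f (x + h) - f x - h * f1 x - h ^+ 2 / 2 * f2 x = g (x + h) - g x.
  by rewrite /g subrr (addrC x) addrK; ring.
have C0 : 0 <= C by exact: le_trans (bd x).
rewrite E normrM (addrC x t) addrK (addrC t x) exprSr mulrA ler_wpM2r//.
apply: le_trans (_ : C * t ^+ 2 <= _).
  exact: taylor1_bound.
by rewrite -(real_normK (num_real t)) ler_wpM2l// lerXn2r ?nnegrE.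
Qed.

(** Written with [expR] and [ln], it is positive for every [v], and its derivative comes from the
    chain rule. *)
Definition rsqrt v := expR (- (ln v / 2)) : K.

Lemma rsqrt_gt0 v : 0 < rsqrt v. Proof. exact: expR_gt0. Qed.

Lemma sqr_rsqrt v : 0 < v -> rsqrt v ^+ 2 = v^-1.
Proof.
move=> v0; rewrite /rsqrt -expRM_natl mulrN mulrC divfK//.
by rewrite expRN lnK ?posrE.
Qed.

Lemma rsqrtE v : 0 < v -> rsqrt v = (Num.sqrt v)^-1.
Proof.
move=> v0; apply/eqP; rewrite -(@eqrXn2 _ 2) ?ltW ?rsqrt_gt0 ?invr_gt0
  ?sqrtr_gt0//.
by rewrite sqr_rsqrt// exprVn sqr_sqrtr// ltW.
Qed.

Lemma der_rsqrt v : 0 < v -> is_derive v (1 : K) rsqrt (- rsqrt v ^+ 3 / 2).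
Proof.
move=> v0; have dln := is_derive1_ln v0.
apply: is_derive_eq; rewrite /GRing.scale /=.
by rewrite -/(rsqrt v) -(sqr_rsqrt v0); field.
Qed.

(** The kernel in the variable p = 1 / sqrt v, in which it is smooth everywhere; time derivatives
    then follow from [der_rsqrt]. *)
Definition gauss p x := p * expR (- (x * p) ^+ 2 / 2) : K.

Definition heat v x := gauss (rsqrt v) x.

Definition heat_x v x := - x * rsqrt v ^+ 2 * heat v x.
Definition heat_xx v x :=
  (x ^+ 2 * rsqrt v ^+ 4 - rsqrt v ^+ 2) * heat v x.
Definition heat_xxx v x :=
  (3 * x * rsqrt v ^+ 4 - x ^+ 3 * rsqrt v ^+ 6) * heat v x.
(** By the heat equation this is a quarter of the fourth space derivative, hence the Hermite
    polynomial y^4 - 6 y^2 + 3 in y = x / sqrt v. *)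
Definition heat_vv v x :=
  (x ^+ 4 * rsqrt v ^+ 8 - 6 * x ^+ 2 * rsqrt v ^+ 6 + 3 * rsqrt v ^+ 4)
  * heat v x / 4.

Lemma heat_gt0 v x : 0 < heat v x.
Proof. by apply: mulr_gt0; exact: expR_gt0. Qed.

#[local] Instance der_heat_x v x : is_derive x (1 : K) (heat v) (heat_x v x).
Proof.
apply: is_derive_eq; rewrite /GRing.scale /=.
by rewrite /heat_x /heat /gauss; field.
Qed.

#[local] Instance der_heat_xx v x : is_derive x (1 : K) (heat_x v) (heat_xx v x).
Proof.
apply: is_derive_eq; rewrite /GRing.scale /=.
by rewrite /heat_x /heat_xx; ring.
Qed.

#[local] Instance der_heat_xxx v x : is_derive x (1 : K) (heat_xx v) (heat_xxx v x).
Proof.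
apply: is_derive_eq; rewrite /GRing.scale /=.
by rewrite /heat_x /heat_xxx; ring.
Qed.

Lemma der_gauss x p : is_derive p (1 : K) (gauss ^~ x)
  ((1 - x ^+ 2 * p ^+ 2) * expR (- (x * p) ^+ 2 / 2)).
Proof.
apply: is_derive_eq; rewrite /GRing.scale /=.
by field.
Qed.

Lemma der_heat_v v x : 0 < v ->
  is_derive v (1 : K) (heat ^~ x) (heat_xx v x / 2).
Proof.
move=> v0; rewrite (_ : _ / 2 = (1 - x ^+ 2 * rsqrt v ^+ 2)
  * expR (- (x * rsqrt v) ^+ 2 / 2) * (- rsqrt v ^+ 3 / 2)).
  exact: (is_derive1_comp (der_gauss _ _) (der_rsqrt v0)).
by rewrite /heat_xx /heat /gauss; field.
Qed.

Lemma der_heat_vv v x : 0 < v ->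
  is_derive v (1 : K) (fun v => heat_xx v x / 2) (heat_vv v x).
Proof.
move=> v0; pose g p := (x ^+ 2 * p ^+ 4 - p ^+ 2) * gauss p x / 2.
have dg p : is_derive p (1 : K) g
    ((6 * x ^+ 2 * p ^+ 2 - 3 - x ^+ 4 * p ^+ 4) * p * gauss p x / 2).
  have := der_gauss x p => dgp; apply: is_derive_eq; rewrite /GRing.scale /=.
  by rewrite /gauss; field.
rewrite (_ : heat_vv v x =
    ((6 * x ^+ 2 * rsqrt v ^+ 2 - 3 - x ^+ 4 * rsqrt v ^+ 4) * rsqrt v
    * gauss (rsqrt v) x / 2) * (- rsqrt v ^+ 3 / 2)).
  exact: (is_derive1_comp (dg _) (der_rsqrt v0)).
by rewrite /heat_vv /heat /gauss; field.
Qed.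

(** From exp s >= 1 + s^2 / 2 at s = t / 2. With t = y^2 it gives y^4 exp (- y^2 / 2) <= 8. *)
Lemma sqr_exp_bound t : 0 <= t -> t ^+ 2 * expR (- t / 2) <= 8 :> K.
Proof.
move=> t0; rewrite mulNr expRN ler_pdivrMr ?expR_gt0//.
have := @expR_ge1Dxn K (t / 2) 1 _; rewrite divr_ge0// => /(_ isT).
by rewrite (_ : 2`!%:R = 2 :> K)//; nra.
Qed.

(* Written in y = x / sqrt v, the derivatives of the heat kernel are powers of
   1 / sqrt v times polynomials in y of degree at most 4 times exp(-y^2/2). *)
Lemma heat_bounds (tau : K) : 0 < tau -> exists2 C : K, 0 < C &
  forall v x, tau <= v ->
  [/\ `|heat v x| <= C, `|heat_x v x| <= C, `|heat_xx v x| <= C,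
      `|heat_xxx v x| <= C & `|heat_vv v x| <= C].
Proof.
move=> tau0; pose q := rsqrt tau.
have q0 : 0 < q := rsqrt_gt0 tau.
(* Each polynomial in y is at most 12 (1 + y^4) in absolute value, so its product with the
   exponential is at most 12 (1 + 8) = 108 <= 200. All five powers of [q] are added since [q] may
   lie on either side of 1. *)
pose C := 200 * (q + q ^+ 2 + q ^+ 3 + q ^+ 4 + q ^+ 5).
have qX n : 0 <= q ^+ n by rewrite exprn_ge0// ltW.
exists C; first by have := (qX 2, qX 3, qX 4, qX 5); rewrite /C; nra.
move=> v x tv; set p := rsqrt v.
have v0 : 0 < v by exact: lt_le_trans tv.
have p0 : 0 < p := rsqrt_gt0 v.
have pq : p <= q.
  by rewrite /p /q ler_expR lerN2 ler_pM2r// ler_ln ?posrE.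
set E := expR (- (x * p) ^+ 2 / 2); set y := x * p.
have E0 : 0 < E := expR_gt0 _.
have E1 : E <= 1.
  by rewrite /E -expR0 ler_expR mulNr oppr_le0 divr_ge0// sqr_ge0.
have E4 : y ^+ 4 * E <= 8.
  by have := @sqr_exp_bound (y ^+ 2) (sqr_ge0 _); rewrite -exprM.
have y2 : 0 <= y ^+ 2 by exact: sqr_ge0.
have key n A : (n < 5)%N -> `|A| <= 12 * (1 + y ^+ 4) ->
    `|p ^+ n.+1 * (A * E)| <= C.
  move=> n5 hA; rewrite normrM (ger0_norm (exprn_ge0 _ (ltW p0))).
  apply: (@le_trans _ _ (q ^+ n.+1 * 200)).
    apply: ler_pM => //; first by rewrite exprn_ge0// ltW.
      by apply: lerXn2r => //; rewrite nnegrE ltW.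
    rewrite normrM (gtr0_norm E0).
    apply: le_trans (ler_wpM2r (ltW E0) hA) _.
    by lra.
  have := (qX 1, qX 2, qX 3, qX 4, qX 5).
  move: n n5 {hA} => [|[|[|[|[|n]]]]]//= _ [[[[]]]] ; rewrite /C ?expr1; lra.
have y4 : 0 <= y ^+ 4 by rewrite (exprM _ 2 2) sqr_ge0.
have y24 : y ^+ 2 * 2 <= 1 + y ^+ 4.
  have := sqr_ge0 (y ^+ 2 - 1); rewrite (_ : y ^+ 4 = (y ^+ 2) ^+ 2) -?exprM//.
  by nra.
have y1 : `|y| * 2 <= 1 + y ^+ 2.
  by have := sqr_ge0 (`|y| - 1); rewrite -(real_normK (num_real y)); nra.
have y3 : `|y| ^+ 3 * 2 <= y ^+ 2 + y ^+ 4.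
  have := sqr_ge0 (`|y| ^+ 2 - `|y|).
  rewrite (exprM _ 2 2) -(real_normK (num_real y)).
  by move: (`|y|) => z; nra.
split.
- rewrite (_ : heat v x = p ^+ 1 * (1 * E)); last by rewrite /heat /gauss -/p -/E; ring.
  by apply: key; rewrite ?normr1//; lra.
- rewrite (_ : heat_x v x = p ^+ 2 * (- y * E)); last first.
    by rewrite /heat_x /heat /gauss -/p -/E /y; ring.
  by apply: key; rewrite // normrN; lra.
- rewrite (_ : heat_xx v x = p ^+ 3 * ((y ^+ 2 - 1) * E)); last first.
    by rewrite /heat_xx /heat /gauss -/p -/E /y; ring.
  by apply: key; rewrite // ler_norml; lra.
- rewrite (_ : heat_xxx v x = p ^+ 4 * ((3 * y - y ^+ 3) * E)); last first.
    by rewrite /heat_xxx /heat /gauss -/p -/E /y; ring.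
  apply: key => //; apply: (le_trans (ler_normB _ _)).
  by rewrite normrM normrX ger0_norm//; lra.
- rewrite (_ : heat_vv v x =
      p ^+ 5 * ((y ^+ 4 - 6 * y ^+ 2 + 3) / 4 * E)); last first.
    by rewrite /heat_vv /heat /gauss -/p -/E /y; field.
  by apply: key; rewrite // ler_norml; lra.
Qed.

(** Serves to replace the time reached by the walk, tau + Var N_n / c_d^2, by the limit variance. *)
Lemma heat_lip (tau : K) : 0 < tau -> exists2 C : K, 0 < C &
  forall v w x, tau <= v -> tau <= w ->
    `|heat v x - heat w x| <= C * `|v - w|.
Proof.
move=> tau0; have [C C0 hC] := heat_bounds tau0; exists C => //.
move=> v w x tv tw; wlog wv : v w tv tw / w <= v => [hw|].
  have [/hw->//|/ltW vw] := leP w v.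
  by rewrite distrC (distrC v); apply: hw.
have dh t : w <= t -> is_derive t (1 : K) (heat ^~ x) (heat_xx t x / 2).
  by move=> wt; exact: der_heat_v (lt_le_trans tau0 (le_trans tw wt)).
have [c /andP[wc cv] /= E] := mean_value_ge wv dh.
rewrite E normrM ler_wpM2r//.
have [_ _ + _ _] := hC c x (le_trans tw wc).
by rewrite !ler_norml; lra.
Qed.

(** Lindeberg's truncation: cubic near 0, so that small increments contribute negligibly, and
    quadratic at infinity, so that a second moment makes it integrable. *)
Definition cut_cube (y : K) := Num.min (y ^+ 2) (`|y| ^+ 3).

(* Lindeberg's one-step estimate: the increment y is compared with letting the
   heat flow for an additional time w. *)
Lemma heat_step (tau : K) : 0 < tau -> exists2 C : K, 0 < C &
  forall v w x y, tau <= v -> 0 <= w ->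
    `|heat v (x + y) - heat (v + w) x - y * heat_x v x
      - (y ^+ 2 - w) / 2 * heat_xx v x| <= C * (cut_cube y + w ^+ 2).
Proof.
move=> tau0; have [C C0 hC] := heat_bounds tau0; exists (C * 2).
  by rewrite mulr_gt0.
move=> v w x y tv w0.
have hx : `|heat v (x + y) - heat v x - y * heat_x v x
    - y ^+ 2 / 2 * heat_xx v x| <= C * 2 * cut_cube y.
  rewrite /cut_cube minEle; case: ifP => _.
    (* Where y^2 is the smaller of the two, a first-order expansion suffices and the second-order
       term is bounded on its own. *)
    have := @taylor1_bound (heat v) (heat_x v) (heat_xx v) x y C
      (fun t _ => der_heat_x _ _) (fun t _ => der_heat_xx _ _).
    move=> /(_ (fun t _ => let: And5 _ _ b _ _ := hC v (x + t) tv in b)) h1.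
    apply: (le_trans (ler_normB _ _)).
    have [_ _ b _ _] := hC v x tv.
    have : `|y ^+ 2 / 2 * heat_xx v x| <= C * y ^+ 2.
      have y2 := sqr_ge0 y.
      rewrite normrM ger0_norm ?divr_ge0// (mulrC C).
      by apply: ler_pM; rewrite ?divr_ge0//; lra.
    by lra.
  have := @taylor2_bound (heat v) (heat_x v) (heat_xx v) (heat_xxx v) x y C
    (der_heat_x _) (der_heat_xx _) (der_heat_xxx _).
  move=> /(_ (fun t => let: And5 _ _ _ b _ := hC v t tv in b)) h1.
  apply: le_trans h1 _; rewrite -mulrA ler_pM2l//.
  by have : 0 <= `|y| ^+ 3 by []; lra.
(* The time derivative is [heat_xx v x / 2], so the first-order gain of the heat flow is exactly the
   w / 2 term of the statement. *)
have hv : `|heat (v + w) x - heat v x - w * (heat_xx v x / 2)| <= C * w ^+ 2.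
  have vw : v <= v + w by rewrite lerDl.
  have pos t : v <= t -> 0 < t by move=> vt; exact: lt_le_trans (le_trans tv vt).
  have := @taylor1_ge (heat ^~ x) _ _ _ _ C vw
    (fun t vt => der_heat_v x (pos t vt)) (fun t vt => der_heat_vv x (pos t vt)).
  rewrite (addrC v) addrK => /= -> // t vt.
  by have [] := hC t x (le_trans tv vt).
rewrite (_ : heat v (x + y) - _ - _ - _ =
  (heat v (x + y) - heat v x - y * heat_x v x - y ^+ 2 / 2 * heat_xx v x)
  - (heat (v + w) x - heat v x - w * (heat_xx v x / 2))); last by field.
apply: (le_trans (ler_normB _ _)).
have : C * w ^+ 2 <= C * 2 * w ^+ 2.
  by rewrite -mulrA ler_pM2l//; have := sqr_ge0 w; lra.
by rewrite mulrDr; lra.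
Qed.

End heat_kernel.

(** * Integrable real functions with a prescribed mean *)

Section mean_value.
Context {K : realType} {d} {X : measurableType d}.
Implicit Types (mu : probability X K) (f g : X -> K) (a b c : K).

(** Bundling integrability with the value lets means be added, scaled and compared as real numbers,
    without side conditions on extended integrals. *)
Definition mean mu f a := mu.-integrable [set: X] (EFin \o f) /\
  (\int[mu]_x (f x)%:E = a%:E)%E.

Lemma mean_uniq mu f a b : mean mu f a -> mean mu f b -> a = b.
Proof. by move=> [_ fa] [_]; rewrite fa => -[]. Qed.

Lemma mean_exists mu f : mu.-integrable [set: X] (EFin \o f) ->
  exists a, mean mu f a.
Proof.
move=> fi; exists (fine (\int[mu]_x (f x)%:E)); split=> //.
by rewrite fineK//; exact: (integrable_fin_num measurableT fi).
Qed.

Lemma mean_measurable mu f a : mean mu f a -> measurable_fun setT f.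
Proof. by move=> [/integrableP[/measurable_EFinP]]. Qed.

Lemma mean_ext mu f g a : f =1 g -> mean mu f a -> mean mu g a.
Proof. by move=> /funext ->. Qed.

Lemma mean_cst mu c : mean mu (fun=> c) c.
Proof.
split; first exact: finite_measure_integrable_cst.
rewrite integral_cst// -[RHS]mule1; congr (_ * _)%E.
exact: probability_setT.
Qed.

Lemma meanZ mu f a c : mean mu f a -> mean mu (fun x => c * f x) (c * a).
Proof.
move=> [fi fa]; split.
  rewrite (_ : _ \o _ = (fun x => c%:E * (f x)%:E)%E); last exact/funext.
  exact: integrableZl.
by under eq_integral do rewrite EFinM; rewrite integralZl// fa EFinM.
Qed.

Lemma meanD mu f g a b : mean mu f a -> mean mu g b ->
  mean mu (fun x => f x + g x) (a + b).
Proof.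
move=> [fi fa] [gi gb]; split.
  rewrite (_ : _ \o _ = (EFin \o f) \+ (EFin \o g))%E; last exact/funext.
  exact: integrableD.
under eq_integral do rewrite EFinD.
by rewrite [LHS](integralD measurableT fi gi) fa gb.
Qed.

Lemma mean_ge0 mu f a : (forall x, 0 <= f x) -> mean mu f a -> 0 <= a.
Proof.
move=> f0 [_ fa]; rewrite -lee_fin -fa.
by apply: integral_ge0 => x _; rewrite lee_fin.
Qed.

Lemma mean_le mu f g a b : (forall x, f x <= g x) ->
  mean mu f a -> mean mu g b -> a <= b.
Proof.
move=> fg fa gb; rewrite -subr_ge0.
apply: (@mean_ge0 mu (fun x => g x + -1 * f x)).
  by move=> x; rewrite mulN1r subr_ge0.
by rewrite -(mulN1r a); apply: meanD => //; exact: meanZ.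
Qed.

(** Domination yields existence and the bound together; error terms whose exact mean is unknown are
    handled this way throughout. *)
Lemma mean_le_exists mu f g b : measurable_fun setT f ->
  (forall x, `|f x| <= g x) -> mean mu g b -> exists2 a, mean mu f a & `|a| <= b.
Proof.
move=> mf fg gb.
have [a fa] : exists a, mean mu f a.
  apply: mean_exists; apply: le_integrable gb.1 => //.
    exact/measurable_EFinP.
  by move=> x _ /=; rewrite lee_fin (le_trans (fg x))// ler_norm.
exists a => //; rewrite ler_norml; apply/andP; split.
  rewrite -[leLHS]mulN1r; apply: mean_le (meanZ _ gb) fa => x.
  by rewrite mulN1r; have := fg x; rewrite ler_norml => /andP[].
by apply: mean_le fa gb => x; rewrite (le_trans _ (fg x))// ler_norm.
Qed.

Lemma mean_bounded mu f M : measurable_fun setT f ->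
  (forall x, `|f x| <= M) -> exists2 a, mean mu f a & `|a| <= M.
Proof. by move=> mf fM; exact: mean_le_exists mf fM (mean_cst _ _). Qed.

Lemma ae_mean mu f g a : measurable_fun setT g ->
  {ae mu, forall x, f x = g x} -> mean mu f a -> mean mu g a.
Proof.
move=> mg fg fa.
have fgE : ae_eq mu setT (EFin \o f) (EFin \o g).
  by apply: filterS fg => x /= -> _.
have mfE := (measurable_EFinP _ _).2 (mean_measurable fa).
have mgE := (measurable_EFinP _ _).2 mg.
have aE : (\int[mu]_x `|(EFin \o f) x| = \int[mu]_x `|(EFin \o g) x|)%E.
  apply: ae_eq_integral => //; [exact: measurableT_comp..|].
  by apply: filterS fg => x /= -> _.
split; last by rewrite -fa.2; apply/esym; exact: ae_eq_integral.
by apply/integrableP; split=> //; rewrite -aE; case/integrableP: fa.1.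
Qed.

Lemma ge0_mean mu f a : measurable_fun setT f -> (forall x, 0 <= f x) ->
  (\int[mu]_x (f x)%:E = a%:E)%E -> mean mu f a.
Proof.
move=> mf f0 fa; split => //; apply/integrableP; split.
  exact/measurable_EFinP.
under eq_integral do rewrite /= ger0_norm//.
by rewrite fa ltry.
Qed.

Lemma mean_sum mu (I : Type) (s : seq I) (F : I -> X -> K) (a : I -> K) :
  (forall i, mean mu (F i) (a i)) ->
  mean mu (fun x => \sum_(i <- s) F i x) (\sum_(i <- s) a i).
Proof.
move=> Fa; elim: s => [|i s IHs].
  rewrite big_nil; apply: mean_ext (mean_cst _ _) => x.
  by rewrite big_nil.
rewrite big_cons; apply: mean_ext (meanD (Fa i) IHs) => x.
by rewrite big_cons.
Qed.

Lemma meanN mu f a : mean mu f a -> mean mu (fun x => - f x) (- a).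
Proof.
move=> fa; rewrite -mulN1r; apply: mean_ext (meanZ (-1) fa) => x.
by rewrite mulN1r.
Qed.

Lemma meanB mu f g a b : mean mu f a -> mean mu g b ->
  mean mu (fun x => f x - g x) (a - b).
Proof. by move=> fa gb; exact: meanD fa (meanN gb). Qed.

Lemma mean0_ae mu f : (forall x, 0 <= f x) -> mean mu f 0 ->
  {ae mu, forall x, f x = 0}.
Proof.
move=> f0 fa.
have mf := (measurable_EFinP _ _).2 (mean_measurable fa).
have := (ae_eq_integral_abs mu measurableT mf).1.
rewrite (_ : (\int[mu]_x `|(EFin \o f) x|)%E = 0%E); last first.
  rewrite -[RHS]fa.2; apply: eq_integral => x _ /=.
  by rewrite ger0_norm.
by move=> /(_ erefl); apply: filterS => x /= /(_ Logic.I)[].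
Qed.

End mean_value.

(** * Means under image laws and product laws *)

Section mean_transport.
Context {K : realType} {d1 d2} {X : measurableType d1} {Y : measurableType d2}.

Lemma mean_distribution (P : probability X K) (V : {RV P >-> Y}) (f : Y -> K) a :
  measurable_fun setT f ->
  mean (distribution P V) f a <-> mean P (f \o V) a.
Proof.
move=> mf; have mV : measurable_fun setT V by [].
have E0 : (\int[distribution P V]_y `|(EFin \o f) y| =
    \int[P]_x `|(EFin \o (f \o V)) x|)%E.
  rewrite ge0_integral_pushforward//.
  exact/measurableT_comp/measurable_EFinP.
have iE : (distribution P V).-integrable setT (EFin \o f) <->
    P.-integrable setT (EFin \o (f \o V)).
  split=> /integrableP[mg fin]; apply/integrableP; split.
  - by apply/measurable_EFinP; exact: measurableT_comp.
  - by rewrite -E0.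
  - exact/measurable_EFinP.
  - by rewrite E0.
split=> -[fi fa]; split.
- exact/iE.
- rewrite -fa integral_distribution//; first exact/measurable_EFinP.
  exact/iE.
- exact/iE.
- by rewrite -[RHS]fa integral_distribution//; exact/measurable_EFinP.
Qed.

(** The iterated integral of |f| |g| factors and is finite, which gives integrability on the
    product; Fubini then evaluates the integral of f g. *)
Lemma mean_prod (mu : probability X K) (nu : probability Y K) f g a b :
  mean mu f a -> mean nu g b ->
  mean (mu \x nu)%E (fun z => f z.1 * g z.2) (a * b).
Proof.
move=> fa gb.
have mfg : measurable_fun setT (fun z : X * Y => f z.1 * g z.2).
  apply: measurable_funM.
    exact: measurableT_comp (mean_measurable fa) measurable_fst.
  exact: measurableT_comp (mean_measurable gb) measurable_snd.
have norm_mean e (Z : measurableType e) (m : probability Z K) (h : Z -> K) c :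
    mean m h c -> exists a, mean m (fun z => `|h z|) a.
  move=> hc; have mh := mean_measurable hc.
  apply: mean_exists; apply: le_integrable hc.1 => //.
    by apply/measurable_EFinP; exact: measurableT_comp.
  by move=> x _ /=; rewrite lee_fin normr_id.
have [a' fa'] := norm_mean _ _ _ _ _ fa.
have [b' gb'] := norm_mean _ _ _ _ _ gb.
have key (f1 : X -> K) (g1 : Y -> K) a1 b1 : mean mu f1 a1 -> mean nu g1 b1 ->
    (\int[mu]_x \int[nu]_y (f1 x * g1 y)%:E = (a1 * b1)%:E)%E.
  move=> f1a g1b; under eq_integral do rewrite (meanZ _ g1b).2.
  by rewrite mulrC -(meanZ b1 f1a).2; apply: eq_integral => x _; rewrite mulrC.
have ifg : (mu \x nu)%E.-integrable setT (EFin \o (fun z => f z.1 * g z.2)).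
  apply/integrable12ltyP; first exact/measurable_EFinP.
  have := key _ _ _ _ fa' gb'.
  under eq_integral do under eq_integral do rewrite -normrM.
  by move=> ->; rewrite ltry.
split => //.
by rewrite -(integral12_prod_meas1 ifg) -(key _ _ _ _ fa gb).
Qed.

End mean_transport.

(** * Independence and integrals *)

Section independence.
Context {K : realType} {d} {T : measurableType d} (P : probability T K).

(** As functions of A, both sides are finite measures, P restricted to B and P scaled by P B; they
    agree on a pi-system containing the whole space, hence on the sigma-algebra it generates. *)
Lemma independent_generated (G : set (set T)) (B : set T) :
  G `<=` measurable -> setI_closed G -> G setT -> measurable B ->
  (forall A, G A -> P (A `&` B) = P A * P B)%E ->
  forall A, <<s G >> A -> P (A `&` B) = (P A * P B)%E.
Proof.
move=> Gm GI GT mB GB A sA.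
have PBfin : P B \is a fin_num := fin_num_measure P B mB.
have c0 : 0 <= fine (P B) by rewrite fine_ge0.
pose m1 : {measure set T -> \bar K} := mrestr P mB.
pose m2 : {measure set T -> \bar K} := mscale (NngNum c0) P.
have := @g_sigma_algebra_measure_unique _ _ _ G Gm (fun=> setT) (fun=> GT)
  _ m1 m2 GI _ _ A sA.
have -> : (P A * P B = m2 A)%E by rewrite /m2 /= /mscale /= fineK// muleC.
apply.
- by rewrite bigcup_const//; exists 0%N.
- by move=> C /GB; rewrite /m1 /m2 /= /mrestr /mscale /= fineK// muleC.
- move=> _; rewrite /m1 /= /mrestr; apply: le_lt_trans (probability_le1 _ _) _.
    exact: measurableI.
  exact: ltry.
Qed.

(** The substitute for conditioning: the law of the pair is the product law, so [Y] can be
    integrated out with [X] frozen. The target of [X] is arbitrary, so that [X] may be the identity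
    of T into a coarser sigma-algebra. *)
Lemma independent_integral d1 d2 (T1 : measurableType d1)
    (T2 : measurableType d2) (X : T -> T1) (Y : {RV P >-> T2})
    (G : T1 * T2 -> \bar K) :
  measurable_fun setT X ->
  (forall A B, measurable A -> measurable B ->
    P (X @^-1` A `&` Y @^-1` B) = (P (X @^-1` A) * P (Y @^-1` B))%E) ->
  measurable_fun setT G -> (forall z, (0 <= G z)%E) ->
  (\int[P]_w G (X w, Y w) = \int[P]_w \int[distribution P Y]_y G (X w, y))%E.
Proof.
move=> mX XY mG G0.
pose X' : {RV P >-> T1} := HB.pack X (isMeasurableFun.Build _ _ _ _ X mX).
have mXY : measurable_fun setT (fun w => (X w, Y w)).
  exact: measurable_fun_pair.
pose Z : {RV P >-> (T1 * T2)%type} :=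
  HB.pack (fun w => (X w, Y w)) (isMeasurableFun.Build _ _ _ _ _ mXY).
rewrite -[LHS](@ge0_integral_distribution _ _ _ _ _ P Z G mG G0).
transitivity (\int[distribution P X' \x distribution P Y]_z G z)%E.
  apply: eq_measure_integral => A mA _; apply/esym.
  apply: product_measure_unique; last exact: mA.
  by move=> A1 A2 mA1 mA2; exact: (XY A1 A2 mA1 mA2).
rewrite fubini_tonelli1//.
apply: (@ge0_integral_distribution _ _ _ _ _ P X').
  exact: measurable_fun_fubini_tonelli_F.
by move=> x; apply: integral_ge0.
Qed.

Lemma same_law_integral d2 (T2 : measurableType d2) (X Y : {RV P >-> T2})
    (f : T2 -> \bar K) : same_law X Y ->
  measurable_fun setT f -> (forall z, (0 <= f z)%E) ->
  (\int[P]_w f (X w) = \int[P]_w f (Y w))%E.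
Proof.
move=> XY mf f0.
rewrite -[LHS](@ge0_integral_distribution _ _ _ _ _ P X f mf f0).
rewrite -[RHS](@ge0_integral_distribution _ _ _ _ _ P Y f mf f0).
by apply: eq_measure_integral => A mA _; exact: XY.
Qed.

Lemma same_law_mean d2 (T2 : measurableType d2) (X Y : {RV P >-> T2})
    (f : T2 -> K) a : same_law X Y -> measurable_fun setT f ->
  mean P (fun w => f (X w)) a -> mean P (fun w => f (Y w)) a.
Proof.
move=> XY mf /(mean_distribution X a mf)[fi fa].
apply/(mean_distribution Y a mf).
split.
  move/integrableP : fi => [mg fi]; apply/integrableP; split=> //.
  rewrite (_ : (\int[_]_x _)%E = (\int[distribution P X]_x `|(EFin \o f) x|)%E)//.
  by apply: eq_measure_integral => A mA _; apply/esym; exact: XY.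
by rewrite -fa; apply: eq_measure_integral => A mA _; apply/esym; exact: XY.
Qed.

Lemma ae_bounded_mean (f : T -> K) M : measurable_fun setT f ->
  {ae P, forall w, `|f w| <= M} -> exists a, mean P f a.
Proof.
move=> mf fM; apply: mean_exists; apply/integrableP; split.
  exact/measurable_EFinP.
apply: (@le_lt_trans _ _ (\int[P]_w (`|M|)%:E)%E).
  apply: ae_ge0_le_integral => //.
    by apply: measurableT_comp => //; exact/measurable_EFinP.
  apply: filterS fM => w /= fw _.
  by rewrite lee_fin (le_trans fw)// ler_norm.
by rewrite (mean_cst P `|M|).2 ltry.
Qed.

End independence.

Lemma measurable_coord (K : realType) m n i j :
  measurable_fun setT (fun u : 'M[K]_(m, n) => u i j).
Proof.
apply: (measurability (@RGenOpens.G K)).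
  exact: RGenOpens.measurableE.
move=> _ [_ [a [b ->]] <-]; rewrite setTI; apply: sub_sigma_algebra.
apply: open_comp => [u _|]; first exact: coord_continuous.
exact: interval_open.
Qed.

(** * Moments of the coordinates of a uniform point on the sphere *)

Section sphere.
Context {K : realType} {d' : nat}.
Local Notation d := d'.+1.
Implicit Types (s u : 'rV[K]_d).

Definition dot s u := \sum_i s ord0 i * u ord0 i.

Lemma dot_mulmx s u : (s *m u^T) ord0 ord0 = dot s u.
Proof. by rewrite mxE; apply: eq_bigr => i _; rewrite mxE. Qed.

Lemma dotC s u : dot s u = dot u s.
Proof. by apply: eq_bigr => i _; rewrite mulrC. Qed.

Lemma dot_sqr s : dot s s = \sum_i s ord0 i ^+ 2.
Proof. by apply: eq_bigr => i _; rewrite expr2. Qed.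

Lemma dot_delta i u : dot (delta_mx ord0 i) u = u ord0 i.
Proof.
rewrite /dot (bigD1 i)//= mxE !eqxx mul1r big1 ?addr0// => j /negPf ji.
by rewrite mxE ji andbF mul0r.
Qed.

Lemma dotDl s t u : dot (s + t) u = dot s u + dot t u.
Proof. by rewrite -big_split; apply: eq_bigr => i _; rewrite mxE mulrDl. Qed.

Lemma dotZl a s u : dot (a *: s) u = a * dot s u.
Proof. by rewrite mulr_sumr; apply: eq_bigr => i _; rewrite mxE mulrA. Qed.

Lemma dotDr s t u : dot u (s + t) = dot u s + dot u t.
Proof. by rewrite !(dotC u) dotDl. Qed.

Lemma dotZr a s u : dot u (a *: s) = a * dot u s.
Proof. by rewrite !(dotC u) dotZl. Qed.

Lemma dot_ge0 s : 0 <= dot s s.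
Proof. by rewrite dot_sqr sumr_ge0// => i _; exact: sqr_ge0. Qed.

Lemma dot_eq0 s : dot s s = 0 -> s = 0.
Proof.
rewrite dot_sqr => /eqP; rewrite psumr_eq0; last by move=> *; exact: sqr_ge0.
move=> /allP s0; apply/rowP => i; rewrite mxE; apply/eqP.
by have := s0 i (mem_index_enum _); rewrite sqrf_eq0.
Qed.

Lemma enorm_sqr s : enorm s ^+ 2 = dot s s.
Proof. by rewrite /enorm -dot_sqr sqr_sqrtr// dot_ge0. Qed.

(* The Householder reflection exchanging s and the first basis vector. *)
Lemma reflection s : dot s s = 1 ->
  exists2 Q : 'M[K]_d, Q *m Q^T = 1%:M & forall u, (u *m Q) ord0 ord0 = dot s u.
Proof.
move=> s1; pose v := delta_mx ord0 ord0 - s : 'rV[K]_d.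
have vE u : dot u v = u ord0 ord0 - dot s u.
  by rewrite /v -scaleN1r dotDr dotZr dotC dot_delta mulN1r dotC.
have [v0|v0] := eqVneq (dot v v) 0.
  exists 1%:M; first by rewrite trmx1 mulmx1.
  move=> u; rewrite mulmx1; apply/eqP; rewrite -subr_eq0 -vE (dot_eq0 v0).
  by rewrite -(scale0r s) dotZr mul0r.
(* For unit s, |e_0 - s|^2 = 2 (1 - s_0). Hence subtracting 2 <u, v> / <v, v> times v from u lowers
   the first coordinate by exactly <u, v> = u_0 - <s, u>. *)
have vvE : dot v v = 2 * v ord0 ord0.
  rewrite vE vE s1 /v !mxE !eqxx /=; ring.
move: v vE v0 vvE => v vE v0 vvE.
pose Q : 'M[K]_d := 1%:M - (2 / dot v v) *: (v^T *m v).
have QT : Q^T = Q.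
  by rewrite /Q [LHS]linearB /= linearZ /= trmx1 trmx_mul trmxK.
exists Q.
  rewrite QT /Q mulmxBl mul1mx mulmxBr mulmx1 -scalemxAl -scalemxAr scalerA.
  rewrite mulmxA -(mulmxA v^T v) [v *m v^T]mx11_scalar dot_mulmx mul_mx_scalar.
  rewrite -scalemxAl scalerA.
  rewrite (_ : _ * dot v v = 2 / dot v v + 2 / dot v v); last by field.
  by rewrite scalerDl !opprB !addrA; apply/eqP; rewrite subr_eq addrAC subrK addrC.
move=> u; rewrite /Q mulmxBr mulmx1 -scalemxAr mulmxA [u *m v^T]mx11_scalar.
rewrite dot_mulmx mul_scalar_mx !mxE.
have v00 : v ord0 ord0 != 0 by apply: contraNneq v0 => vz; rewrite vvE vz mulr0.
by rewrite vvE vE; field.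
Qed.

Context {mu : probability 'rV[K]_d K} (hmu : uniform_on_sphere mu).

Lemma measurable_dot s : measurable_fun setT (dot s).
Proof.
apply: measurable_sum => i; apply: measurable_funM => //.
exact: measurable_coord.
Qed.

HB.instance Definition _ s := isMeasurableFun.Build _ _ _ _ (dot s)
  (measurable_dot s).

Lemma uniform_norm1 : {ae mu, forall u, dot u u = 1}.
Proof.
have mA : measurable [set u : 'rV[K]_d | dot u u = 1].
  have mf : measurable_fun setT (fun u : 'rV[K]_d => dot u u).
    by apply: measurable_sum => i; apply: measurable_funM; exact: measurable_coord.
  rewrite (_ : [set u | _] = setT `&` (fun u => dot u u) @^-1` [set 1]).
    exact: mf.
  by rewrite setTI.
exists (~` [set u | dot u u = 1]); split=> //.
  exact: measurableC.
rewrite probability_setC//.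
have := hmu.1; rewrite (_ : [set x | enorm x = 1] = [set u | dot u u = 1]).
  by move=> ->; rewrite subee.
apply/seteqP; split=> u /=; first by move=> u1; rewrite -enorm_sqr u1 expr1n.
by move=> u1; rewrite /enorm -dot_sqr u1 sqrtr1.
Qed.

Let e0 : 'rV[K]_d := delta_mx ord0 ord0.

(** The reflection attached to s / |s| turns [dot s] into |s| times the first coordinate, and the
    law is invariant under it. The null vector has no direction and is treated apart. *)
Lemma uniform_dot_law (s : 'rV[K]_d) :
  same_law (dot s : {RV mu >-> K}) (dot (enorm s *: e0) : {RV mu >-> K}).
Proof.
move=> A mA; rewrite /distribution /pushforward.
have [s0|s0] := eqVneq (dot s s) 0.
  have := enorm_sqr s; rewrite s0 => /eqP; rewrite sqrf_eq0 => /eqP ->.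
  by rewrite (dot_eq0 s0) scale0r.
have n0 : enorm s != 0 by rewrite -sqrf_eq0 enorm_sqr.
have [|Q QQ Qs] := @reflection ((enorm s)^-1 *: s).
  by rewrite dotZl dotZr -enorm_sqr; field.
rewrite -(hmu.2 Q QQ ((dot (enorm s *: e0)) @^-1` A)); last first.
  by rewrite -[X in measurable X]setTI; exact: measurable_dot.
congr (mu _); apply/seteqP; split=> u /=;
  by rewrite dotZl /e0 dot_delta Qs dotZl mulrA divff// mul1r.
Qed.

Lemma uniform_dot_mean s (f : K -> K) a : measurable_fun setT f ->
  mean mu (fun u => f (enorm s * u ord0 ord0)) a ->
  mean mu (fun u => f (dot s u)) a.
Proof.
move=> mf fa; have sl : same_law (dot (enorm s *: e0) : {RV mu >-> K}) (dot s).
  by move=> A mA; apply/esym; exact: uniform_dot_law.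
apply: (same_law_mean sl mf); apply: mean_ext fa => u.
by rewrite /= dotZl dot_delta.
Qed.

Lemma uniform_dot_integral s (f : K -> \bar K) : measurable_fun setT f ->
  (forall z, (0 <= f z)%E) ->
  (\int[mu]_u f (dot s u) = \int[mu]_u f (enorm s * u ord0 ord0)%R)%E.
Proof.
move=> mf f0; rewrite (same_law_integral (@uniform_dot_law s) mf f0).
by apply: eq_integral => u _; congr (f _); rewrite /= dotZl dot_delta.
Qed.

Lemma coord_le1 : {ae mu, forall u, forall i, `|u ord0 i| <= 1}.
Proof.
apply: filterS uniform_norm1 => u; rewrite dot_sqr => u1 i.
rewrite -(@expr_le1 _ 2)// -normrX ger0_norm ?sqr_ge0// -u1 (bigD1 i)//=.
by rewrite lerDl sumr_ge0// => j _; exact: sqr_ge0.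
Qed.

Let enorm_delta i : enorm (delta_mx ord0 i : 'rV[K]_d) = 1.
Proof. by rewrite /enorm -dot_sqr dot_delta mxE !eqxx sqrtr1. Qed.

Lemma coord_mean i (f : K -> K) a : measurable_fun setT f ->
  mean mu (fun u => f (u ord0 ord0)) a -> mean mu (fun u => f (u ord0 i)) a.
Proof.
move=> mf fa; have := @uniform_dot_mean (delta_mx ord0 i) f a mf.
rewrite enorm_delta => h; apply: mean_ext (h _) => [u|].
  by rewrite dot_delta.
by apply: mean_ext fa => u; rewrite mul1r.
Qed.

(** The vector - e_0 has the same norm as e_0, so the mean equals its opposite. *)
Lemma coord_mean1 : mean mu (fun u => u ord0 ord0) 0.
Proof.
have [a fa] : exists a, mean mu (fun u => u ord0 ord0) a.
  apply: (@ae_bounded_mean _ _ _ _ _ 1); first exact: measurable_coord.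
  by apply: filterS coord_le1 => u /(_ ord0).
have := @uniform_dot_mean (-1 *: e0) id a (@measurable_id _ _ _).
rewrite (_ : enorm _ = 1); last first.
  rewrite /enorm -dot_sqr dotZl dotZr dot_delta mxE !eqxx.
  by rewrite !mulN1r opprK sqrtr1.
have fa1 : mean mu (fun u => id (1 * u ord0 ord0)) a.
  by apply: mean_ext fa => u; rewrite mul1r.
move=> /(_ fa1) h; have := mean_uniq (meanN fa) (mean_ext _ h).
move=> /(_ (fun u => _)) aE; rewrite (_ : 0 = a)//.
suff : - a = a by lra.
by apply: aE => u; rewrite /= dotZl dot_delta mulN1r.
Qed.

(** The d coordinates have equal second moments, and these add up to 1. *)
Lemma coord_mean2 : mean mu (fun u => u ord0 ord0 ^+ 2) d%:R^-1.
Proof.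
have [a fa] : exists a, mean mu (fun u => u ord0 ord0 ^+ 2) a.
  apply: (@ae_bounded_mean _ _ _ _ _ 1).
    by apply: measurable_funX; exact: measurable_coord.
  by apply: filterS coord_le1 => u /(_ ord0); rewrite normrX; exact: exprn_ile1.
have : mean mu (fun u : 'rV[K]_d => \sum_(i < d) u ord0 i ^+ 2)
    (\sum_(i < d) a).
  apply: mean_sum => i; apply: (@coord_mean i (fun y => y ^+ 2)) => //.
have h : mean mu (fun u : 'rV[K]_d => \sum_(i < d) u ord0 i ^+ 2) 1.
  apply: ae_mean (mean_cst mu 1).
    apply: measurable_sum => i.
    by apply: measurable_funX; exact: measurable_coord.
  by apply: filterS uniform_norm1 => u; rewrite dot_sqr.
move=> /(mean_uniq h); rewrite sumr_const card_ord -[a *+ _]mulr_natl => da.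
rewrite (_ : _^-1 = a)//; apply: (@mulfI _ d%:R); rewrite ?pnatr_eq0//.
by rewrite -da divff// pnatr_eq0.
Qed.

(** Comparing the directions e_i + e_j and e_i - e_j with e_0 gives E u_i^2 u_j^2 = a / 3 for
    distinct i, j, while the diagonal terms equal a >= a / 3. All d^2 of them sum to E |u|^4 = 1,
    hence d^2 a / 3 <= 1. *)
Lemma coord_mean4 : exists2 a,
  mean mu (fun u => u ord0 ord0 ^+ 4) a & a <= 3 / d%:R ^+ 2.
Proof.
have [a fa] : exists a, mean mu (fun u => u ord0 ord0 ^+ 4) a.
  apply: (@ae_bounded_mean _ _ _ _ _ 1).
    by apply: measurable_funX; exact: measurable_coord.
  by apply: filterS coord_le1 => u /(_ ord0); rewrite normrX; exact: exprn_ile1.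
exists a => //.
have mX4 : measurable_fun setT (fun y : K => y ^+ 4).
  exact: measurable_funX.
have a0 : 0 <= a.
  by apply: mean_ge0 fa => u; rewrite (exprM _ 2 2) sqr_ge0.
have fi i : mean mu (fun u => u ord0 i ^+ 4) a.
  exact: (@coord_mean i (fun y => y ^+ 4)).
(* Adding the cases c = 1 and c = -1 leaves the mean of u_i^2 u_j^2. *)
have rot i j c : i != j -> c ^+ 2 = 1 ->
    mean mu (fun u => (u ord0 i + c * u ord0 j) ^+ 4) (4 * a).
  move=> ij c1; pose s : 'rV[K]_d := delta_mx ord0 i + c *: delta_mx ord0 j.
  have s2 : enorm s ^+ 4 = 4.
    rewrite (exprM _ 2 2) enorm_sqr /s dotDl dotZl !dot_delta !mxE !eqxx /=.
    rewrite (negPf ij) eq_sym (negPf ij) /= mulr0 addr0 mulr1 add0r -expr2 c1.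
    by ring.
  apply: mean_ext (@uniform_dot_mean s _ _ mX4 _) => [u|].
    by rewrite /s dotDl dotZl !dot_delta.
  by apply: mean_ext (meanZ 4 fa) => u; rewrite exprMn s2.
have pair i j : exists2 b, mean mu (fun u => u ord0 i ^+ 2 * u ord0 j ^+ 2) b
    & a / 3 <= b.
  have [<-|ij] := eqVneq i j.
    exists a; last by lra.
    by apply: mean_ext (fi i) => u; rewrite -exprD.
  exists (a / 3) => //.
  have h := meanD (rot i j 1 ij (expr1n _ _)) (rot i j (-1) ij _).
  have h2 := meanZ (12^-1) (meanB (h _) (meanZ 2 (meanD (fi i) (fi j)))).
  rewrite (_ : a / 3 = 12^-1 * (4 * a + 4 * a - 2 * (a + a))); last by field.
  apply: mean_ext (h2 _) => [u|]; first by field.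
  by rewrite sqrrN expr1n.
have [|b bP] := @choice _ _ (fun (p : 'I_d * 'I_d) b => mean mu (fun u =>
    u ord0 p.1 ^+ 2 * u ord0 p.2 ^+ 2) b /\ a / 3 <= b).
  by move=> [i j]; have [b ? ?] := pair i j; exists b.
have hs := mean_sum (index_enum _) (fun p => (bP p).1).
have b1 : \sum_p b p = 1.
  apply: mean_uniq hs _; apply: ae_mean (mean_cst mu 1).
    apply: measurable_sum => p; apply: measurable_funM;
      by apply: measurable_funX; exact: measurable_coord.
  apply: filterS uniform_norm1 => u u1.
  rewrite -(pair_bigA _ (fun i j => u ord0 i ^+ 2 * u ord0 j ^+ 2)) /=.
  under eq_bigr do rewrite -mulr_sumr.
  by rewrite -mulr_suml -dot_sqr u1 mulr1.
have : \sum_(p : 'I_d * 'I_d) (a / 3) <= 1.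
  by rewrite -[leRHS]b1; apply: ler_sum => p _; have [] := bP p.
rewrite sumr_const card_prod card_ord -[a / 3 *+ _]mulr_natr natrM -expr2.
rewrite ler_pdivlMr ?exprn_gt0//; lra.
Qed.

End sphere.

(** * Constants for the test functions and inequalities for the truncated cube *)

Section heat_test_functions.
Context {K : realType}.
Implicit Types (a b v x tau C : K).

Lemma measurable_heat v : measurable_fun setT (heat v : K -> K).
Proof.
apply: measurable_funM => //; apply: measurableT_comp => //.
apply: measurable_funM => //; apply: measurableT_comp => //.
by apply: measurable_funX; exact: measurable_funM.
Qed.

Lemma cut_cube_ge0 a : 0 <= cut_cube a.
Proof. by rewrite /cut_cube le_min sqr_ge0 exprn_ge0. Qed.

Definition heat_const tau C := [/\ 0 < C,
  forall v w x y, tau <= v -> 0 <= w ->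
    `|heat v (x + y) - heat (v + w) x - y * heat_x v x
      - (y ^+ 2 - w) / 2 * heat_xx v x| <= C * (cut_cube y + w ^+ 2)
  & forall v x, tau <= v -> `|heat v x| <= C /\ `|heat_xx v x| <= C].

Lemma heat_const_exists tau : 0 < tau -> exists C, heat_const tau C.
Proof.
move=> tau0; have [C1 C10 h1] := heat_step tau0.
have [C2 C20 h2] := heat_bounds tau0; exists (C1 + C2); split.
- exact: addr_gt0.
- move=> v w x y tv w0; apply: le_trans (h1 v w x y tv w0) _.
  apply: ler_wpM2r; last by lra.
  by apply: addr_ge0; [exact: cut_cube_ge0|exact: sqr_ge0].
- by move=> v x tv; have [? _ ? _ _] := h2 v x tv; split; lra.
Qed.

Lemma measurable_cut_cube : measurable_fun setT (@cut_cube K).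
Proof.
apply: measurable_minr; first exact: measurable_funX.
by apply: measurable_funX; exact: normr_measurable.
Qed.

(** |a + b| is at most twice the larger of |a| and |b|, whence 8 = 2^3. The asymmetry is deliberate:
    [a] will be the radial part, known to have two moments, and [b] the spherical part, which has
    four. *)
Lemma cut_cubeD a b : cut_cube (a + b) <= 8 * cut_cube a + 8 * `|b| ^+ 3.
Proof.
have := ler_normD a b; set s := `|a + b| => sab.
have a0 := normr_ge0 a; have b0 := normr_ge0 b; have s0 : 0 <= s by exact: normr_ge0.
have b3 : 0 <= `|b| ^+ 3 by exact: exprn_ge0.
have ca := cut_cube_ge0 a.
have [ba|ab] := leP `|b| `|a|.
  suff : cut_cube (a + b) <= 8 * cut_cube a by lra.
  have s2a : s <= 2 * `|a| by lra.
  have h2 : s ^+ 2 <= 4 * `|a| ^+ 2 by nra.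
  have h3 : s ^+ 3 <= 8 * `|a| ^+ 3.
    rewrite (_ : 8 * `|a| ^+ 3 = (2 * `|a|) ^+ 3); last by ring.
    by apply: lerXn2r => //; rewrite nnegrE; lra.
  rewrite /cut_cube -/s -(real_normK (num_real (a + b))) -/s.
  rewrite -(real_normK (num_real a)) !minEle.
  have := sqr_ge0 `|a|; have : 0 <= `|a| ^+ 3 by exact: exprn_ge0.
  by case: (leP (s ^+ 2)) => ?; case: (leP (`|a| ^+ 2)) => ? ? ?; lra.
apply: (@le_trans _ _ (s ^+ 3)); first by rewrite /cut_cube ge_min lexx orbT.
suff : s ^+ 3 <= 8 * `|b| ^+ 3 by lra.
have s2b : s <= 2 * `|b| by lra.
rewrite (_ : 8 * `|b| ^+ 3 = (2 * `|b|) ^+ 3); last by ring.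
by apply: lerXn2r => //; rewrite nnegrE; lra.
Qed.

(** The difference of the two sides is b^2 (eps - |b|)^2 / (2 eps). It trades the third moment for
    the second and fourth, which are explicit. *)
Lemma cube_le b eps : 0 < eps ->
  `|b| ^+ 3 <= (eps * b ^+ 2 + b ^+ 4 / eps) / 2.
Proof.
move=> e0; rewrite (exprM b 2 2) -(real_normK (num_real b)).
have := mulr_ge0 (sqr_ge0 (eps - `|b|)) (mulr_ge0 (sqr_ge0 `|b|) (ltW (_ : 0 < eps^-1))).
rewrite invr_gt0 => /(_ e0); set t := `|b| => h.
have -> : (eps * t ^+ 2 + (t ^+ 2) ^+ 2 / eps) / 2 =
    t ^+ 3 + (eps - t) ^+ 2 * (t ^+ 2 * eps^-1) / 2.
  by field; rewrite gt_eqF.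
by lra.
Qed.

End heat_test_functions.

(** * The squared norm of the walk: independence of the past, transitions, moments *)

Section walk_chain.
Context {K : realType} {disp} {T : measurableType disp} (P : probability T K).

Lemma preimage_bigcap_ordS d2 (T2 : measurableType d2) (X : nat -> {RV P >-> T2}) n B :
  \bigcap_(i in `I_n) (X i @^-1` B i) `&` X n @^-1` B n =
  \bigcap_(i in `I_n.+1) (X i @^-1` B i).
Proof.
apply/seteqP; split=> w /=.
  by move=> [wB wn] i /=; rewrite ltnS leq_eqVlt => /predU1P[->//|/wB].
by move=> wB; split=> [i /= ik|]; apply: wB => //=; exact: ltnW.
Qed.

Lemma independent_last d2 (T2 : measurableType d2) (X : nat -> {RV P >-> T2})
    (B : nat -> set T2) k : independent_RVs X -> (forall i, measurable (B i)) ->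
  P (\bigcap_(i in `I_k) (X i @^-1` B i) `&` X k @^-1` B k) =
  (P (\bigcap_(i in `I_k) (X i @^-1` B i)) * P (X k @^-1` B k))%E.
Proof.
move=> XI mB; pose J (n : nat) := [fset i in iota 0 n]%fset.
have JE n : [set` J n] = `I_n.
  by apply/seteqP; split=> i /=; rewrite !inE mem_iota.
have JP n : P (\bigcap_(i in `I_n) (X i @^-1` B i)) =
    (\prod_(i <- J n) P (X i @^-1` B i))%E.
  rewrite -JE; apply: XI => i _; exists (B i) => //; by rewrite setTI.
have inJ n i : (i \in J n) = (i < n)%N by rewrite !inE mem_iota.
have JS : J k.+1 = (k |` J k)%fset.
  by apply/fsetP => i; rewrite in_fset1U !inJ ltnS leq_eqVlt.
by rewrite preimage_bigcap_ordS !JP JS big_fsetU1 ?inJ ?ltnn// muleC.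
Qed.

Context {d' : nat}.
Local Notation d := d'.+1.
Context (Rs : nat -> {RV P >-> K}) (U : nat -> {RV P >-> 'rV[K]_d}).
Hypothesis Rs_indep : independent_RVs Rs.
Hypothesis U_indep : independent_RVs U.
Hypothesis RU_indep : independent_families Rs U.
Hypothesis U_unif : forall i, uniform_on_sphere (distribution P (U i)).

Let capR (j : nat) (B : nat -> set K) := \bigcap_(i in `I_j) (Rs i @^-1` B i).
Let capU (k : nat) (C : nat -> set 'rV[K]_d) :=
  \bigcap_(i in `I_k) (U i @^-1` C i).

(* A pi-system generating the sigma-algebra of R_0 .. R_(j-1) and
   U_0 .. U_(k-1). *)
Definition past (j k : nat) : set (set T) :=
  [set A | exists B C, [/\ forall i, measurable (B i),
    forall i, measurable (C i) & A = capR j B `&` capU k C]].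

Let mcap d2 (T2 : measurableType d2) (X : nat -> {RV P >-> T2}) n B :
  (forall i, measurable (B i)) ->
  measurable (\bigcap_(i in `I_n) (X i @^-1` B i)).
Proof.
move=> mB; apply: fin_bigcap_measurable => // i _.
by rewrite -[X in measurable X]setTI; exact: measurable_funP.
Qed.

Lemma past_measurable j k : past j k `<=` measurable.
Proof. by move=> _ [B [C [mB mC ->]]]; apply: measurableI; exact: mcap. Qed.

Lemma past_setI j k : setI_closed (past j k).
Proof.
move=> _ _ [B [C [mB mC ->]]] [B' [C' [mB' mC' ->]]].
exists (fun i => B i `&` B' i), (fun i => C i `&` C' i); split=> [i|i|].
- exact: measurableI.
- exact: measurableI.
- by rewrite setIACA /capR /capU -!bigcapI.
Qed.

Lemma past_setT j k : past j k setT.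
Proof.
exists (fun=> setT), (fun=> setT); split=> //.
by rewrite /capR /capU !bigcapT// setTI.
Qed.

Let scap d2 (T2 : measurableType d2) (X : nat -> {RV P >-> T2}) n B :
  (forall i, measurable (B i)) ->
  sigma_family X (\bigcap_(i in `I_n) (X i @^-1` B i)).
Proof.
move=> mB.
pose G := \bigcup_i g_sigma_algebra_preimage (X i).
apply: (@fin_bigcap_measurable _ (g_sigma_algebraType G)) => // i _.
by apply: sub_sigma_algebra; exists i => //; exists (B i) => //; rewrite setTI.
Qed.

(** Puts [D] in slot [n], which an intersection over [I_n] does not see; an event on the n-th
    variable thus joins the intersection over [I_n.+1]. *)
Let upd d2 (T2 : measurableType d2) (B : nat -> set T2) n D i :=
  if i == n then D else B i.

Let capupd d2 (T2 : measurableType d2) (X : nat -> {RV P >-> T2}) n B D :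
  \bigcap_(i in `I_n) (X i @^-1` upd B n D i) =
  \bigcap_(i in `I_n) (X i @^-1` B i).
Proof.
by apply: eq_bigcapr => i /= ik; rewrite /upd ltn_eqF.
Qed.

(** On the generating pi-system: separate radii from directions by [RU_indep], factor out the last
    direction, and put radii and directions together again. *)
Lemma past_independent_U j k (D : set 'rV[K]_d) : measurable D ->
  forall A, <<s past j k >> A ->
  P (A `&` U k @^-1` D) = (P A * P (U k @^-1` D))%E.
Proof.
move=> mD; apply: independent_generated.
- exact: past_measurable.
- exact: past_setI.
- exact: past_setT.
- by rewrite -[X in measurable X]setTI; exact: measurable_funP.
move=> _ [B [C [mB mC ->]]].
have mC' i : measurable (upd C k D i) by rewrite /upd; case: ifP.
have CE : capU k C = capU k (upd C k D) by rewrite /capU capupd.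
have DE : D = upd C k D k by rewrite /upd eqxx.
rewrite -setIA RU_indep; [|exact: scap|]; last first.
  by rewrite CE {2}DE /capU preimage_bigcap_ordS; exact: scap.
rewrite CE {2 4}DE (independent_last _ U_indep mC') muleA; congr (_ * _)%E.
by rewrite RU_indep //; exact: scap.
Qed.

Lemma past_independent_R j k (D : set K) : measurable D ->
  forall A, <<s past j k >> A ->
  P (A `&` Rs j @^-1` D) = (P A * P (Rs j @^-1` D))%E.
Proof.
move=> mD; apply: independent_generated.
- exact: past_measurable.
- exact: past_setI.
- exact: past_setT.
- by rewrite -[X in measurable X]setTI; exact: measurable_funP.
move=> _ [B [C [mB mC ->]]].
have mB' i : measurable (upd B j D i) by rewrite /upd; case: ifP.
have BE : capR j B = capR j (upd B j D) by rewrite /capR capupd.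
have DE : D = upd B j D j by rewrite /upd eqxx.
rewrite setIAC RU_indep; [| |exact: scap]; last first.
  by rewrite BE {2}DE /capR preimage_bigcap_ordS; exact: scap.
rewrite BE {2 4}DE (independent_last _ Rs_indep mB') muleAC; congr (_ * _)%E.
by rewrite RU_indep //; exact: scap.
Qed.

Local Notation Tp j k := (g_sigma_algebraType (past j k)).

Lemma past_measurable_R j k i : (i < j)%N ->
  measurable_fun setT (Rs i : Tp j k -> K).
Proof.
move=> ij _ B mB; rewrite setTI; apply: sub_sigma_algebra.
exists (upd (fun=> setT) i B), (fun=> setT); split=> //.
  by move=> l; rewrite /upd; case: ifP.
rewrite /capU bigcapT// setIT; apply/seteqP; split=> w /=.
  by move=> wB l _; rewrite /= /upd; case: eqP => [->|].
by move=> /(_ i ij); rewrite /= /upd eqxx.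
Qed.

Lemma past_measurable_U j k i : (i < k)%N ->
  measurable_fun setT (U i : Tp j k -> 'rV[K]_d).
Proof.
move=> ik _ B mB; rewrite setTI; apply: sub_sigma_algebra.
exists (fun=> setT), (upd (fun=> setT) i B); split=> //.
  by move=> l; rewrite /upd; case: ifP.
rewrite /capR bigcapT// setTI; apply/seteqP; split=> w /=.
  by move=> wB l _; rewrite /= /upd; case: eqP => [->|].
by move=> /(_ i ik); rewrite /= /upd eqxx.
Qed.

(** This identity is the variable to which [independent_integral] is applied: the whole past is
    frozen at once. *)
Lemma past_measurable_id j k : measurable_fun setT (id : T -> Tp j k).
Proof.
move=> _ A sA; rewrite setTI preimage_id.
exact: (smallest_sub (@sigma_algebra_measurable _ T) (@past_measurable j k)).
Qed.

Let S := walk Rs U.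
Definition sqnorm k w := dot (S k w) (S k w).

Let coordS k w l : S k w ord0 l = \sum_(i < k) Rs i w * U i w ord0 l.
Proof.
by rewrite /S /walk summxE; apply: eq_bigr => i _; rewrite !mxE.
Qed.

Let past_measurable_S j k n l : (n <= j)%N -> (n <= k)%N ->
  measurable_fun setT (fun w : Tp j k => S n w ord0 l).
Proof.
move=> nj nk; rewrite (_ : (fun w => _) =
    (fun w => \sum_(i < n) Rs i w * U i w ord0 l)); last first.
  by apply/funext => w; rewrite coordS.
apply: measurable_sum => i; apply: measurable_funM.
  by apply: past_measurable_R; exact: leq_trans nj.
apply: (measurableT_comp (measurable_coord ord0 l)).
by apply: past_measurable_U; exact: leq_trans nk.
Qed.

Lemma past_measurable_sqnorm j k n : (n <= j)%N -> (n <= k)%N ->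
  measurable_fun setT (sqnorm n : Tp j k -> K).
Proof.
move=> nj nk; apply: measurable_sum => l.
by apply: measurable_funM; exact: past_measurable_S.
Qed.

Lemma measurable_sqnorm n : measurable_fun setT (sqnorm n : T -> K).
Proof.
apply: (@measurableT_comp _ _ _ _ _ _ (sqnorm n : Tp n n -> K)).
  exact: past_measurable_sqnorm.
exact: past_measurable_id.
Qed.

Lemma sqnorm_ge0 n w : 0 <= sqnorm n w. Proof. exact: dot_ge0. Qed.

Lemma sqnorm0 w : sqnorm 0 w = 0.
Proof.
by rewrite /sqnorm /S /walk big_ord0 -(scale0r (0 : 'rV[K]_d)) dotZl mul0r.
Qed.

Lemma sqnormS n w : dot (U n w) (U n w) = 1 ->
  sqnorm n.+1 w = sqnorm n w + 2 * Rs n w * dot (S n w) (U n w) + Rs n w ^+ 2.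
Proof.
move=> U1; rewrite /sqnorm /S /walk big_ord_recr /= !(dotDl, dotDr).
rewrite !(dotZl, dotZr) U1 (dotC (U n w)); ring.
Qed.

(* The law of <S_n, u> under the uniform measure depends on |S_n| only. *)
Lemma sqnorm_step n (F : K -> \bar K) : measurable_fun setT F ->
  (forall x, (0 <= F x)%E) ->
  (\int[P]_w F (sqnorm n.+1 w) =
   \int[P]_w \int[distribution P (Rs n)]_r \int[distribution P (U n)]_u
     F (sqnorm n w + 2 * r * (Num.sqrt (sqnorm n w) * u ord0 ord0) + r ^+ 2)%R)%E.
Proof.
move=> mF F0.
(* The indices [n.+1] and [n] freeze R_n together with S_n while U_n is integrated out; R_n is
   separated from the past afterwards. *)
pose G1 (z : Tp n.+1 n * 'rV[K]_d) := F (sqnorm n z.1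
  + 2 * Rs n z.1 * dot (S n z.1) z.2 + Rs n z.1 ^+ 2).
have mG1 : measurable_fun setT G1.
  apply: measurableT_comp => //.
  have mR : measurable_fun setT (fun z : Tp n.+1 n * 'rV[K]_d => Rs n z.1).
    apply: (measurableT_comp (f := Rs n : Tp n.+1 n -> K)) => //.
    exact: past_measurable_R.
  apply: measurable_funD; last exact: measurable_funX.
  apply: measurable_funD.
    apply: (measurableT_comp (f := sqnorm n : Tp n.+1 n -> K)) => //.
    exact: past_measurable_sqnorm.
  apply: measurable_funM; first exact: measurable_funM.
  apply: measurable_sum => l; apply: measurable_funM.
    apply: (measurableT_comp (f := fun w : Tp n.+1 n => S n w ord0 l)) => //.
    exact: past_measurable_S.
  by apply: (measurableT_comp (measurable_coord ord0 l)).
(* The expansion of |S_n + R_n U_n|^2 uses |U_n| = 1, which holds almost surely only. *)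
transitivity (\int[P]_w G1 (w, U n w))%E.
  apply: ae_eq_integral => //.
  - apply: measurableT_comp => //; exact: measurable_sqnorm.
  - apply: (measurableT_comp mG1); apply: measurable_fun_pair => //.
    exact: past_measurable_id.
  - have [N [mN N0 UN]] := uniform_norm1 (U_unif n).
    exists (U n @^-1` N); split.
    + by rewrite -[X in measurable X]setTI; exact: measurable_funP.
    + exact: N0.
    + move=> w /= h; apply: UN => /= U1; apply: h => _.
      by rewrite /G1 /= sqnormS.
transitivity (\int[P]_w \int[distribution P (U n)]_u G1 (w, u))%E.
  apply: (@independent_integral _ _ _ P _ _ _ _ (id : T -> Tp n.+1 n)) => //.
    exact: past_measurable_id.
    by move=> A B mA mB; exact: (past_independent_U mB mA).
  by move=> z; exact: F0.
have msqrt : measurable_fun setT (@Num.sqrt K).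
  by apply: continuous_measurable_fun; exact: sqrt_continuous.
pose G2 (z : K * K) := (\int[distribution P (U n)]_u
  F (z.1 + 2 * z.2 * (Num.sqrt z.1 * u ord0 ord0) + z.2 ^+ 2)%R)%E.
have mG2 : measurable_fun setT G2.
  apply: (@measurable_fun_fubini_tonelli_F _ _ _ _ _ (distribution P (U n))
    (fun zu : (K * K) * 'rV[K]_d => F (zu.1.1
    + 2 * zu.1.2 * (Num.sqrt zu.1.1 * zu.2 ord0 ord0) + zu.1.2 ^+ 2)%R)) => //.
  apply: measurableT_comp => //.
  have m11 : measurable_fun setT (fun zu : (K * K) * 'rV[K]_d => zu.1.1).
    exact: (measurableT_comp (f := fst)).
  have m12 : measurable_fun setT (fun zu : (K * K) * 'rV[K]_d => zu.1.2).
    exact: (measurableT_comp (f := snd)).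
  apply: measurable_funD; last exact: measurable_funX.
  apply: measurable_funD => //.
  apply: measurable_funM; first exact: measurable_funM.
  apply: measurable_funM; first exact: (measurableT_comp msqrt m11).
  exact: (measurableT_comp (measurable_coord ord0 ord0)).
(* For a frozen past the direction enters through <S_n, u> only, which may be replaced by |S_n| u_0;
   from here on S_n appears only through its norm. *)
transitivity (\int[P]_w G2 (sqnorm n w, Rs n w))%E.
  apply: eq_integral => w _; rewrite /G1 /G2 /=.
  apply: (@uniform_dot_integral _ _ _ (U_unif n) (S n w)
    (fun y => F (sqnorm n w + 2 * Rs n w * y + Rs n w ^+ 2))) => //.
  apply: measurableT_comp => //.
  apply: measurable_funD => //; apply: measurable_funD => //.
apply: (@independent_integral _ _ _ P _ _ _ _ (sqnorm n) (Rs n) G2) => //.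
- exact: measurable_sqnorm.
- move=> A B mA mB; apply: (@past_independent_R n n) => //.
  rewrite -[X in _ X]setTI.
  exact: (@past_measurable_sqnorm n n n (leqnn n) (leqnn n) measurableT A mA).
- by move=> z; apply: integral_ge0.
Qed.

(** [Q] is the image of [F] under the transition operator of the chain; nonnegativity of [F] makes
    Tonelli available. *)
Lemma mean_sqnormS n (F Q : K -> K) a :
  measurable_fun setT F -> (forall x, 0 <= F x) ->
  (forall x, 0 <= x -> mean (distribution P (Rs n) \x distribution P (U n))%E
    (fun z => F (x + 2 * z.1 * (Num.sqrt x * z.2 ord0 ord0) + z.1 ^+ 2)) (Q x)) ->
  mean P (fun w => Q (sqnorm n w)) a -> mean P (fun w => F (sqnorm n.+1 w)) a.
Proof.
move=> mF F0 FQ Qa; apply: ge0_mean.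
- by apply: measurableT_comp => //; exact: measurable_sqnorm.
- by move=> w; exact: F0.
rewrite (@sqnorm_step n (EFin \o F)) //; last 1 first.
- exact/measurable_EFinP.
rewrite -Qa.2; apply: eq_integral => w _.
have [_ <-] := FQ _ (sqnorm_ge0 n w).
rewrite fubini_tonelli1 //.
  by have [/integrableP[]] := FQ _ (sqnorm_ge0 n w).
by move=> z; rewrite lee_fin; exact: F0.
Qed.

(** The same transition when the image of [F] is only known to be within [E] of [H]. The exact image
    exists because [F] is bounded, and it is measurable as a partial integral. *)
Lemma mean_sqnormS_approx n (F H E : K -> K) M a b :
  measurable_fun setT F -> (forall x, 0 <= F x) -> (forall x, F x <= M) ->
  (forall x q, 0 <= x -> mean (distribution P (Rs n) \x distribution P (U n))%E
    (fun z => F (x + 2 * z.1 * (Num.sqrt x * z.2 ord0 ord0) + z.1 ^+ 2)) q ->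
    `|q - H x| <= E x) ->
  mean P (fun w => H (sqnorm n w)) a -> mean P (fun w => E (sqnorm n w)) b ->
  exists2 e, mean P (fun w => F (sqnorm n.+1 w)) e & `|e - a| <= b.
Proof.
move=> mF F0 FM FH Ha Eb.
pose mu : probability (K * 'rV[K]_d)%type K :=
  (distribution P (Rs n) \x distribution P (U n))%E.
pose f (w : T) (z : K * 'rV[K]_d) := F (sqnorm n w
  + 2 * z.1 * (Num.sqrt (sqnorm n w) * z.2 ord0 ord0) + z.1 ^+ 2).
have msqrt : measurable_fun setT (@Num.sqrt K).
  by apply: continuous_measurable_fun; exact: sqrt_continuous.
have mf : measurable_fun setT (fun p : T * (K * 'rV[K]_d) => f p.1 p.2).
  apply: measurableT_comp => //.
  have m1 : measurable_fun setT (fun p : T * (K * 'rV[K]_d) => sqnorm n p.1).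
    exact: (measurableT_comp (measurable_sqnorm n)).
  have m21 : measurable_fun setT (fun p : T * (K * 'rV[K]_d) => p.2.1).
    exact: (measurableT_comp (f := fst)).
  have m22 : measurable_fun setT (fun p : T * (K * 'rV[K]_d) => p.2.2).
    exact: (measurableT_comp (f := snd)).
  apply: measurable_funD; last exact: measurable_funX.
  apply: measurable_funD => //.
  apply: measurable_funM; first exact: measurable_funM.
  apply: measurable_funM; first exact: (measurableT_comp msqrt m1).
  exact: (measurableT_comp (measurable_coord ord0 ord0)).
have fq w : exists q, mean mu (f w) q.
  have [|z|q fq _] := @mean_bounded _ _ _ mu (f w) M.
  - exact: (measurableT_comp mf (measurable_pair1 w)).
  - by rewrite /f ger0_norm.
  - by exists q.
have [q qP] := choice fq.
have qE w : (\int[mu]_z (f w z)%:E)%E = (q w)%:E by have [] := qP w.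
have mq : measurable_fun setT q.
  apply/measurable_EFinP.
  have := @measurable_fun_fubini_tonelli_F _ _ _ _ _ mu
    (fun p : T * (K * 'rV[K]_d) => (f p.1 p.2)%:E).
  rewrite (_ : fubini_F _ _ = EFin \o q); last exact/funext.
  apply; last by move=> p; rewrite lee_fin; exact: F0.
  by apply/measurable_EFinP; exact: mf.
have qH w : `|q w - H (sqnorm n w)| <= E (sqnorm n w).
  by apply: FH; [exact: sqnorm_ge0|exact: qP].
have [e' qe' e'b] := mean_le_exists
  (measurable_funB mq (mean_measurable Ha)) qH Eb.
have qe : mean P q (e' + a).
  by apply: mean_ext (meanD qe' Ha) => w; rewrite subrK.
exists (e' + a); last by rewrite addrK.
apply: ge0_mean.
- by apply: measurableT_comp => //; exact: measurable_sqnorm.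
- by move=> w; exact: F0.
rewrite (@sqnorm_step n (EFin \o F)) //; last 1 first.
- exact/measurable_EFinP.
rewrite -qe.2; apply: eq_integral => w _.
rewrite -qE fubini_tonelli1 //.
  by have [/integrableP[]] := qP w.
by move=> z; rewrite lee_fin; exact: F0.
Qed.

Context (R : {RV P >-> K}) (m4 : K).
Hypothesis Rs_law : forall i, same_law (Rs i) R.
Hypothesis R2 : mean P (fun w => R w ^+ 2) 1.
Hypothesis R4 : mean P (fun w => R w ^+ 4) m4.

Section one_step.
Variable n : nat.
Let mu := (distribution P (Rs n) \x distribution P (U n))%E.

Let meanR (f : K -> K) a : measurable_fun setT f ->
  mean P (fun w => f (R w)) a -> mean (distribution P (Rs n)) f a.
Proof.
move=> mf fa; apply/(mean_distribution (Rs n) a mf).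
apply: (@same_law_mean _ _ _ P _ _ R (Rs n)) fa => // A mA.
by rewrite Rs_law.
Qed.

Let mX k : measurable_fun setT (fun r : K => r ^+ k).
Proof. exact: measurable_funX. Qed.

Let meanRU (f : K -> K) (g : 'rV[K]_d -> K) a b : measurable_fun setT f ->
  mean P (fun w => f (R w)) a -> mean (distribution P (U n)) g b ->
  mean mu (fun z => f z.1 * g z.2) (a * b).
Proof. by move=> mf fa gb; apply: mean_prod => //; exact: meanR. Qed.

Let mean1 := coord_mean1 (U_unif n).
Let mean2 := coord_mean2 (U_unif n).

(** Existence is all that is asked here and in [R3_exists]: these moments get multiplied by the zero
    mean of a coordinate. *)
Lemma R1_exists : exists a, mean P (fun w => R w) a.
Proof.
have [|||a Ra _] := @mean_le_exists _ _ _ P R (fun w => 1 + R w ^+ 2) (1 + 1).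
- by [].
- move=> w; have := sqr_ge0 (`|R w| - 1).
  by rewrite -(real_normK (num_real (R w))); have := normr_ge0 (R w); nra.
- exact: meanD (mean_cst P 1) R2.
by exists a.
Qed.

Lemma R3_exists : exists a, mean P (fun w => R w ^+ 3) a.
Proof.
have [|||a Ra _] := @mean_le_exists _ _ _ P (fun w => R w ^+ 3)
    (fun w => R w ^+ 2 + R w ^+ 4) (1 + m4).
- by apply: measurable_funX.
- move=> w; rewrite normrX (exprM _ 2 2) -(real_normK (num_real (R w))).
  have := sqr_ge0 (`|R w| ^+ 2 - `|R w|); have := normr_ge0 (R w).
  by move: (`|R w|) => z; nra.
- exact: meanD R2 R4.
by exists a.
Qed.

Let y (z : K * 'rV[K]_d) := z.2 ord0 ord0.

Lemma mean_r2 : mean mu (fun z => z.1 ^+ 2) 1.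
Proof.
rewrite -(mulr1 1); apply: mean_ext (meanRU (mX 2) R2 (mean_cst _ 1)) => z.
by rewrite mulr1.
Qed.

Lemma mean_r4 : mean mu (fun z => z.1 ^+ 4) m4.
Proof.
rewrite -(mulr1 m4); apply: mean_ext (meanRU (mX 4) R4 (mean_cst _ 1)) => z.
by rewrite mulr1.
Qed.

Lemma mean_ry : mean mu (fun z => z.1 * y z) 0.
Proof.
have [a Ra] := R1_exists; rewrite -(mulr0 a).
exact: (meanRU (@measurable_id _ _ _) Ra mean1).
Qed.

Lemma mean_r3y : mean mu (fun z => z.1 ^+ 3 * y z) 0.
Proof.
by have [a Ra] := R3_exists; rewrite -(mulr0 a); exact: (meanRU (mX 3) Ra mean1).
Qed.

Lemma mean_r2y2 : mean mu (fun z => z.1 ^+ 2 * y z ^+ 2) d%:R^-1.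
Proof. by rewrite -[_^-1]mul1r; exact: (meanRU (mX 2) R2 mean2). Qed.

Lemma mean_r4y4 : exists2 a, mean mu (fun z => z.1 ^+ 4 * y z ^+ 4) a &
  a <= m4 * (3 / d%:R ^+ 2).
Proof.
have [a Ua a3] := coord_mean4 (U_unif n).
exists (m4 * a); first exact: (meanRU (mX 4) R4 Ua).
apply: ler_wpM2l a3; apply: mean_ge0 R4 => w.
by rewrite (exprM _ 2 2) sqr_ge0.
Qed.

Lemma mean_fr (f : K -> K) a : measurable_fun setT f ->
  mean P (fun w => f (R w)) a -> mean mu (fun z => f z.1) a.
Proof.
move=> mf fa; rewrite -(mulr1 a).
by apply: mean_ext (meanRU mf fa (mean_cst _ 1)) => z; rewrite mulr1.
Qed.

(** The increment of the chain from state x, with the inner product <S, U> in its equivalent form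
    sqrt x * u_0. *)
Definition incr (x : K) (z : K * 'rV[K]_d) :=
  2 * z.1 * (Num.sqrt x * z.2 ord0 ord0) + z.1 ^+ 2.

Lemma mean_incr x : mean mu (incr x) 1.
Proof.
rewrite (_ : 1 = 2 * Num.sqrt x * 0 + 1); last by ring.
apply: mean_ext (meanD (meanZ (2 * Num.sqrt x) mean_ry) mean_r2) => z.
by rewrite /incr /y; ring.
Qed.

Lemma mean_incr2 x : 0 <= x ->
  mean mu (fun z => incr x z ^+ 2) (m4 + 4 * x / d%:R).
Proof.
move=> x0.
rewrite (_ : _ + _ = m4 + 4 * Num.sqrt x * 0 + 4 * x * d%:R^-1); last by ring.
apply: mean_ext (meanD (meanD mean_r4 (meanZ (4 * Num.sqrt x) mean_r3y))
  (meanZ (4 * x) mean_r2y2)) => z.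
by rewrite /incr /y -{2}(sqr_sqrtr x0); ring.
Qed.

End one_step.

(** [mean_sqnormS] wants a nonnegative function, and x^2 + lam x + 1 is one on the whole line for
    lam in [0, 1]. The case lam = 0 yields the second moment, and subtracting it from lam = 1 yields
    the first. *)
Let step_poly n lam e1 e2 (l01 : 0 <= lam <= 1) :
  mean P (fun w => sqnorm n w) e1 -> mean P (fun w => sqnorm n w ^+ 2) e2 ->
  mean P (fun w => sqnorm n.+1 w ^+ 2 + lam * sqnorm n.+1 w + 1)
    (e2 + 2 * e1 + m4 + 4 * e1 / d%:R + lam * (e1 + 1) + 1).
Proof.
move=> h1 h2.
apply: (@mean_sqnormS n (fun x => x ^+ 2 + lam * x + 1)
  (fun x => x ^+ 2 + (2 + 4 / d%:R + lam) * x + (m4 + lam + 1))).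
- apply: measurable_funD => //; apply: measurable_funD; first exact: measurable_funX.
  exact: measurable_funM.
- move=> x; have := sqr_ge0 (x + lam / 2); nra.
- move=> x x0.
  rewrite (_ : _ + _ = (x ^+ 2 + lam * x + 1) + (2 * x + lam) * 1
    + (m4 + 4 * x / d%:R)); last by ring.
  apply: mean_ext (meanD (meanD (mean_cst _ _)
    (meanZ (2 * x + lam) (mean_incr n x))) (mean_incr2 n x0)) => z.
  by rewrite /incr; ring.
have -> : e2 + 2 * e1 + m4 + 4 * e1 / d%:R + lam * (e1 + 1) + 1 =
  e2 + (2 + 4 / d%:R + lam) * e1 + (m4 + lam + 1) by ring.
exact: meanD (meanD h2 (meanZ _ h1)) (mean_cst _ _).
Qed.

Definition sqnorm_var n : K := n%:R * (m4 - 1) + 2 * n%:R * (n%:R - 1) / d%:R.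

Lemma sqnorm_moments n : mean P (fun w => sqnorm n w) n%:R /\
  mean P (fun w => sqnorm n w ^+ 2) (n%:R ^+ 2 + sqnorm_var n).
Proof.
elim: n => [|n [h1 h2]].
  split; first by apply: mean_ext (mean_cst P 0) => w; rewrite sqnorm0.
  have -> : 0%:R ^+ 2 + sqnorm_var 0 = 0 by rewrite /sqnorm_var; ring.
  by apply: mean_ext (mean_cst P 0) => w; rewrite sqnorm0 expr0n.
have p0 := step_poly (lam := 0) _ h1 h2; have p1 := step_poly (lam := 1) _ h1 h2.
have {}p0 := p0 ltac:(lra); have {}p1 := p1 ltac:(lra).
have e1 : mean P (fun w => sqnorm n.+1 w) n.+1%:R.
  rewrite (_ : n.+1%:R = (n%:R ^+ 2 + sqnorm_var n + 2 * n%:R + m4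
    + 4 * n%:R / d%:R + 1 * (n%:R + 1) + 1) - (n%:R ^+ 2 + sqnorm_var n
    + 2 * n%:R + m4 + 4 * n%:R / d%:R + 0 * (n%:R + 1) + 1)); last first.
    by rewrite -natr1; ring.
  by apply: mean_ext (meanB p1 p0) => w; ring.
split => //.
rewrite (_ : _ + _ = (n%:R ^+ 2 + sqnorm_var n
    + 2 * n%:R + m4 + 4 * n%:R / d%:R + 0 * (n%:R + 1) + 1) - 1); last first.
  have d0 : (d%:R : K) != 0 by rewrite pnatr_eq0.
  by rewrite /sqnorm_var -natr1; move: (d%:R : K) d0 => D D0; field.
by apply: mean_ext (meanB p0 (mean_cst P 1)) => w; ring.
Qed.

Lemma sqnorm_variance n :
  mean P (fun w => (sqnorm n w - n%:R) ^+ 2) (sqnorm_var n).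
Proof.
have [h1 h2] := sqnorm_moments n.
rewrite (_ : sqnorm_var n = n%:R ^+ 2 + sqnorm_var n - 2 * n%:R * n%:R
  + n%:R ^+ 2); last by ring.
apply: mean_ext (meanD (meanB h2 (meanZ (2 * n%:R) h1)) (mean_cst P (n%:R ^+ 2))).
by move=> w; ring.
Qed.

Lemma m4_ge1 : 1 <= m4.
Proof.
have h : mean P (fun w => (R w ^+ 2 - 1) ^+ 2) (m4 - 2 * 1 + 1).
  by apply: mean_ext (meanD (meanB R4 (meanZ 2 R2)) (mean_cst P 1)) => w; ring.
by have := mean_ge0 (fun w => sqr_ge0 _) h; lra.
Qed.

(** * Lindeberg replacement along the chain *)

Section lindeberg.
Variables (tau C c eps gam : K).
Hypotheses (hC : heat_const tau C) (c0 : 0 < c) (eps0 : 0 < eps).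
Hypothesis hgam : mean P (fun w => cut_cube ((R w ^+ 2 - 1) / c)) gam.

Variable D : K.
Hypothesis DE : d%:R = D.

Let D0 : 0 < D. Proof. by rewrite -DE ltr0n. Qed.

(** The conditional variance of the k-th normalised increment with N_k replaced by its mean k. *)
Definition step_time k : K := (m4 - 1 + 4 * k%:R / D) / c ^+ 2.

(** In order: the cost of replacing N_k = x by k in the conditional variance, the truncated radial
    part, the second and fourth moments of the spherical part (192 = 4 * 16 * 3), and the squared
    time step. *)
Definition step_error k (x : K) :=
  ((c + (x - k%:R) ^+ 2 / c) / (D * c ^+ 2) + 8 * gam + 16 * eps * x / (D * c ^+ 2)
   + 192 * m4 * x ^+ 2 / (D ^+ 2 * c ^+ 4 * eps) + step_time k ^+ 2).

Lemma step_time_ge0 k : 0 <= step_time k.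
Proof.
apply: divr_ge0; last exact: sqr_ge0.
apply: addr_ge0; first by rewrite subr_ge0 m4_ge1.
by apply: divr_ge0; [rewrite mulr_ge0|exact: ltW].
Qed.

(** The normalised increment [xi] is the sum of a radial part [A] and a spherical part [b]. Its mean
    is zero, which removes the [heat_x] term; [cut_cubeD] and [cube_le] bound the remainder by the
    truncated moment of [A] and the second and fourth moments of [b]. *)
Lemma heat_one_step k a m x q : tau <= a -> 0 <= x ->
  mean (distribution P (Rs k) \x distribution P (U k))%E
    (fun z => heat a ((x + incr x z - k.+1%:R) / c - m)) q ->
  `|q - heat (a + step_time k) ((x - k%:R) / c - m)| <= C * step_error k x.
Proof.
move=> ta x0 hq; case: hC => C0 hstep hbd.
set w := step_time k; set p := (x - k%:R) / c - m.
have cN : c != 0 by rewrite gt_eqF.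
have eN : eps != 0 by rewrite gt_eqF.
have DN : D != 0 by rewrite gt_eqF.
have mi2 := mean_incr2 k x0; rewrite DE in mi2.
have m22 := mean_r2y2 k; rewrite DE in m22.
have := mean_r4y4 k; rewrite DE => -[a4 ha4 a43].
pose xi z := (incr x z - 1) / c.
pose A (z : K * 'rV[K]_d) := (z.1 ^+ 2 - 1) / c.
pose b (z : K * 'rV[K]_d) := 2 * z.1 * (Num.sqrt x * z.2 ord0 ord0) / c.
have xiE z : xi z = A z + b z by rewrite /xi /incr /A /b; ring.
have hxi : mean (distribution P (Rs k) \x distribution P (U k))%E xi 0.
  rewrite (_ : 0 = c^-1 * (1 - 1)); last by ring.
  by apply: mean_ext (meanZ c^-1 (meanB (mean_incr k x) (mean_cst _ 1))) => z;
    rewrite /xi mulrC.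
have hxi2 : mean (distribution P (Rs k) \x distribution P (U k))%E
    (fun z => xi z ^+ 2) ((m4 - 1 + 4 * x / D) / c ^+ 2).
  rewrite (_ : _ / _ = (c ^+ 2)^-1 * (m4 + 4 * x / D - 2 * 1 + 1)); last first.
    by field; rewrite cN DN.
  apply: mean_ext (meanZ _ (meanD (meanB mi2
    (meanZ 2 (mean_incr k x))) (mean_cst _ 1))) => z.
  by rewrite /xi; field.
have hA : mean (distribution P (Rs k) \x distribution P (U k))%E
    (fun z => cut_cube (A z)) gam.
  apply: (@mean_fr k (fun r => cut_cube ((r ^+ 2 - 1) / c))) hgam.
  apply: (measurableT_comp measurable_cut_cube).
  by apply: measurable_funM => //; apply: measurable_funB => //; exact: measurable_funX.
have hb2 : mean (distribution P (Rs k) \x distribution P (U k))%E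
    (fun z => b z ^+ 2) (4 * x / c ^+ 2 * D^-1).
  apply: mean_ext (meanZ (4 * x / c ^+ 2) m22) => z.
  by rewrite /b -{1}(sqr_sqrtr x0); field.
have hb4 : mean (distribution P (Rs k) \x distribution P (U k))%E
    (fun z => b z ^+ 4) (16 * x ^+ 2 / c ^+ 4 * a4).
  apply: mean_ext (meanZ (16 * x ^+ 2 / c ^+ 4) ha4) => z.
  by rewrite /b -{1}(sqr_sqrtr x0); field.
pose Tz z := heat a (p + xi z) - heat (a + w) p - xi z * heat_x a p
  - (xi z ^+ 2 - w) / 2 * heat_xx a p.
have hq' : mean (distribution P (Rs k) \x distribution P (U k))%E
    (fun z => heat a (p + xi z)) q.
  apply: mean_ext hq => z; congr heat.
  by rewrite /p /xi -natr1; field.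
pose t := q - heat (a + w) p - heat_x a p * 0
  - heat_xx a p / 2 * ((m4 - 1 + 4 * x / D) / c ^+ 2 - w).
have hT : mean (distribution P (Rs k) \x distribution P (U k))%E Tz t.
  apply: mean_ext (meanB (meanB (meanB hq' (mean_cst _ (heat (a + w) p)))
    (meanZ (heat_x a p) hxi)) (meanZ (heat_xx a p / 2)
    (meanB hxi2 (mean_cst _ w)))) => z.
  by rewrite /Tz; ring.
pose Bz z := C * (8 * cut_cube (A z)
  + 4 * (eps * b z ^+ 2 + eps^-1 * b z ^+ 4) + w ^+ 2).
pose beta := C * (8 * gam + 4 * (eps * (4 * x / c ^+ 2 * D^-1)
  + eps^-1 * (16 * x ^+ 2 / c ^+ 4 * a4)) + w ^+ 2).
have hB : mean (distribution P (Rs k) \x distribution P (U k))%E Bz beta.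
  apply: meanZ; apply: meanD (mean_cst _ _); apply: meanD; first exact: meanZ.
  by apply: meanZ; apply: meanD; exact: meanZ.
have TB z : `|Tz z| <= Bz z.
  apply: le_trans (hstep a w p (xi z) ta (step_time_ge0 k)) _.
  rewrite ler_pM2l// lerD2r xiE.
  have := cut_cubeD (A z) (b z); have := @cube_le _ (b z) _ eps0.
  by rewrite (mulrC eps^-1); lra.
have [t' ht' t'b] := mean_le_exists (mean_measurable hT) TB hB.
rewrite (mean_uniq ht' hT) in t'b.
(* The second-order term survives: the conditional variance at x differs from [step_time k] by 4 (x
   - k) / (D c^2), of which half multiplies [heat_xx]. *)
have -> : q - heat (a + w) p = t + heat_xx a p * (2 * (x - k%:R) / (D * c ^+ 2)).
  rewrite /t /w /step_time; field; rewrite cN DN //.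
have [_ hxx] := hbd a p ta.
(* Arithmetic-geometric mean with weight c, so that the mean of this error involves only the
   variance of N_k. *)
have xk : `|x - k%:R| * 2 <= c + (x - k%:R) ^+ 2 / c.
  rewrite -(real_normK (num_real (x - k%:R))).
  have -> : c + `|x - k%:R| ^+ 2 / c =
      `|x - k%:R| * 2 + (`|x - k%:R| - c) ^+ 2 / c by field.
  by rewrite lerDl divr_ge0 ?sqr_ge0 ?ltW.
have hlin : `|heat_xx a p * (2 * (x - k%:R) / (D * c ^+ 2))| <=
    C * ((c + (x - k%:R) ^+ 2 / c) / (D * c ^+ 2)).
  have dc0 : 0 < (D * c ^+ 2)^-1 by rewrite invr_gt0 mulr_gt0// exprn_gt0.
  rewrite normrM; apply: ler_pM => //.
  rewrite normrM (gtr0_norm dc0) ler_pM2r// normrM ger0_norm//.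
  by rewrite mulrC.
have hbeta : beta <= C * (8 * gam + 16 * eps * x / (D * c ^+ 2)
   + 192 * m4 * x ^+ 2 / (D ^+ 2 * c ^+ 4 * eps) + w ^+ 2).
  rewrite /beta ler_pM2l// lerD2r.
  have -> : 16 * eps * x / (D * c ^+ 2) = 4 * (eps * (4 * x / c ^+ 2 * D^-1)).
    by field; rewrite cN DN.
  have -> : 192 * m4 * x ^+ 2 / (D ^+ 2 * c ^+ 4 * eps) =
      4 * (eps^-1 * (16 * x ^+ 2 / c ^+ 4 * (m4 * (3 / D ^+ 2)))).
    by field; rewrite cN DN eN.
  rewrite mulrDr addrA lerD2l ler_pM2l// ler_pM2l ?invr_gt0//.
  by apply: ler_wpM2l a43; apply: divr_ge0;
    [rewrite mulr_ge0 ?sqr_ge0 | rewrite exprn_ge0// ltW].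
apply: le_trans (ler_normD _ _) _.
apply: le_trans (lerD (le_trans t'b hbeta) hlin) _.
by rewrite -mulrDr ler_pM2l// /step_error -/w; lra.
Qed.

Variable n : nat.

(** The mean of [step_error k] at k = n; each of its terms is nondecreasing in k, so it serves for
    all steps. *)
Definition step_bound := ((c + sqnorm_var n / c) / (D * c ^+ 2) + 8 * gam
   + 16 * eps * n%:R / (D * c ^+ 2)
   + 192 * m4 * (n%:R ^+ 2 + sqnorm_var n) / (D ^+ 2 * c ^+ 4 * eps)
   + step_time n ^+ 2).

(** The step times telescope, so the heat flow receives exactly the variance of the normalised
    chain. *)
Lemma sqnorm_varS k : sqnorm_var k.+1 / c ^+ 2 = sqnorm_var k / c ^+ 2 + step_time k.
Proof.
rewrite /sqnorm_var /step_time -natr1 DE; field.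
by rewrite !gt_eqF.
Qed.

Lemma sqnorm_var_le k l : (k <= l)%N -> sqnorm_var k <= sqnorm_var l.
Proof.
elim: l => [|l IH]; first by rewrite leqn0 => /eqP ->.
rewrite leq_eqVlt => /predU1P[->//|]; rewrite ltnS => /IH kl.
apply: le_trans kl _; have := sqnorm_varS l; have := step_time_ge0 l => h0 h.
have c2 : 0 < (c ^+ 2)^-1 by rewrite invr_gt0 exprn_gt0.
by rewrite -(ler_pM2r c2) h lerDl.
Qed.

Lemma mean_step_error k : (k <= n)%N ->
  exists2 e, mean P (fun w => step_error k (sqnorm k w)) e & e <= step_bound.
Proof.
move=> kn; have [h1 h2] := sqnorm_moments k; have h3 := sqnorm_variance k.
have [cN eN DN] : [/\ c != 0, eps != 0 & D != 0] by split; rewrite gt_eqF.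
exists ((c + sqnorm_var k / c) / (D * c ^+ 2) + 8 * gam
   + 16 * eps * k%:R / (D * c ^+ 2)
   + 192 * m4 * (k%:R ^+ 2 + sqnorm_var k) / (D ^+ 2 * c ^+ 4 * eps)
   + step_time k ^+ 2).
  rewrite (_ : _ + step_time k ^+ 2 = c / (D * c ^+ 2) + 8 * gam
    + step_time k ^+ 2 + (c * (D * c ^+ 2))^-1 * sqnorm_var k
    + 16 * eps / (D * c ^+ 2) * k%:R
    + 192 * m4 / (D ^+ 2 * c ^+ 4 * eps) * (k%:R ^+ 2 + sqnorm_var k)); last first.
    by field; rewrite cN eN DN.
  apply: mean_ext (meanD (meanD (meanD (mean_cst P _) (meanZ _ h3)) (meanZ _ h1))
    (meanZ _ h2)) => w.
  by rewrite /step_error; field; rewrite cN eN DN.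
have kn' : k%:R <= n%:R :> K by rewrite ler_nat.
have vkn := sqnorm_var_le kn; have m41 := m4_ge1.
have k0 : 0 <= k%:R :> K by [].
have dc0 : 0 < (D * c ^+ 2)^-1 by rewrite invr_gt0 mulr_gt0// exprn_gt0.
have dce0 : 0 < (D ^+ 2 * c ^+ 4 * eps)^-1.
  by rewrite invr_gt0 !mulr_gt0// exprn_gt0.
have st : step_time k <= step_time n.
  rewrite /step_time ler_pM2r ?invr_gt0 ?exprn_gt0// lerD2l ler_pM2r ?invr_gt0//.
  by rewrite ler_pM2l.
apply: lerD; last by rewrite lerXn2r ?nnegrE ?step_time_ge0.
apply: lerD.
  apply: lerD.
    by rewrite lerD2r ler_pM2r// lerD2l ler_pM2r// invr_gt0.
  by rewrite ler_pM2r// ler_pM2l// mulr_gt0.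
rewrite ler_pM2r// ler_pM2l; last by lra.
by apply: lerD => //; rewrite lerXn2r ?nnegrE.
Qed.

Lemma heat_walk m : exists2 e,
  mean P (fun w => heat tau ((sqnorm n w - n%:R) / c - m)) e &
  `|e - heat (tau + sqnorm_var n / c ^+ 2) (- m)| <= n%:R * (C * step_bound).
Proof.
(* The variance still to come after k steps. At k = 0 all of it sits in the heat flow and N_0 = 0
   makes the comparison exact; at k = n none is left. *)
pose time k := sqnorm_var n / c ^+ 2 - sqnorm_var k / c ^+ 2.
have time_ge0 k : (k <= n)%N -> 0 <= time k.
  move=> /sqnorm_var_le kn.
  by rewrite /time -mulrBl mulr_ge0 ?subr_ge0// invr_ge0 sqr_ge0.
suff H k : (k <= n)%N -> exists2 e,
    mean P (fun w => heat (tau + time k) ((sqnorm k w - k%:R) / c - m)) e &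
    `|e - heat (tau + sqnorm_var n / c ^+ 2) (- m)| <= k%:R * (C * step_bound).
  have [e he hb] := H n (leqnn n); exists e; last exact: hb.
  by apply: mean_ext he => w; rewrite /time subrr addr0.
case: hC => C0 _ hbd.
elim: k => [_|k IH kn].
  exists (heat (tau + sqnorm_var n / c ^+ 2) (- m)); last by rewrite subrr normr0 mul0r.
  apply: mean_ext (mean_cst P _) => w; rewrite sqnorm0 subrr mul0r sub0r.
  congr heat; rewrite /time (_ : sqnorm_var 0 = 0) ?mul0r ?subr0//.
  by rewrite /sqnorm_var; ring.
have [e he hb] := IH (ltnW kn).
have [r hr rb] := mean_step_error (ltnW kn).
have tk : tau <= tau + time k.+1 by rewrite lerDl time_ge0.
have [|||||| e' he' e'b] := @mean_sqnormS_approx k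
   (fun x => heat (tau + time k.+1) ((x - k.+1%:R) / c - m))
   (fun x => heat (tau + time k) ((x - k%:R) / c - m))
   (fun x => C * step_error k x) C e (C * r).
- apply: (measurableT_comp (measurable_heat _)).
  apply: measurable_funB => //; apply: measurable_funM => //.
  exact: measurable_funB.
- by move=> x; rewrite ltW ?heat_gt0.
- move=> x; have [h _] := hbd _ ((x - k.+1%:R) / c - m) tk.
  exact: le_trans (ler_norm _) h.
- move=> x q x0 hq.
  have -> : tau + time k = tau + time k.+1 + step_time k.
    by rewrite /time sqnorm_varS; ring.
  apply: heat_one_step => //.
  by apply: mean_ext hq => z; rewrite /incr !addrA.
- exact: he.
- exact: meanZ.
exists e' => //; have -> : k.+1%:R * (C * step_bound) =
  k%:R * (C * step_bound) + C * step_bound by rewrite -[k.+1%:R]natr1; ring.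
have e'b' : `|e' - e| <= C * step_bound.
  by apply: le_trans e'b _; rewrite ler_pM2l.
have := lerD e'b' hb; rewrite [leRHS]addrC; apply: le_trans.
rewrite (_ : e' - heat (tau + sqnorm_var n / c ^+ 2) (- m) =
  (e' - e) + (e - heat (tau + sqnorm_var n / c ^+ 2) (- m))); last by ring.
exact: ler_normD.
Qed.

End lindeberg.

End walk_chain.

(** * Normal densities as heat kernels, and Gaussian tails *)

Section normal_heat.
Context {K : realType}.
Implicit Types (v x y m : K).
Local Notation leb := (@lebesgue_measure K).

Definition gauss_cst : K := (Num.sqrt (2 * pi))^-1.

Lemma gauss_cst_gt0 : 0 < gauss_cst.
Proof. by rewrite invr_gt0 sqrtr_gt0 mulr_gt0// pi_gt0. Qed.

Lemma normal_pdf_heat v m x : 0 < v ->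
  normal_pdf m (Num.sqrt v) x = gauss_cst * heat v (x - m).
Proof.
move=> v0; have s0 : 0 < Num.sqrt v by rewrite sqrtr_gt0.
rewrite normal_pdfE ?gt_eqF// /normal_peak /normal_fun sqr_sqrtr ?ltW//.
rewrite /heat /gauss mulrA; congr (_ * expR _).
  rewrite rsqrtE// /gauss_cst -invfM -sqrtrM; last by rewrite mulr_ge0// pi_ge0.
  by congr (Num.sqrt _)^-1; rewrite -mulr_natl; ring.
by rewrite exprMn sqr_rsqrt// -mulr_natl; field; rewrite gt_eqF.
Qed.

Lemma heatN v x : heat v (- x) = heat v x :> K.
Proof. by rewrite /heat /gauss; congr (_ * expR _); field. Qed.

(** With t = u^2 / (4 v) the exponential is exp (- t) twice: one factor absorbs u^2 through t exp (-
    t) <= 1, the other belongs to variance 2 v. A tail bound of Chebyshev type then follows from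
    total mass 1 alone. *)
Lemma heat_tail v delta u : 0 < v -> delta <= `|u| -> 0 < delta ->
  heat v u <= 8 * v / delta ^+ 2 * heat (2 * v) u :> K.
Proof.
move=> v0 du d0; have v20 : 0 < 2 * v by rewrite mulr_gt0.
rewrite mulrAC ler_pdivlMr ?exprn_gt0//.
have pv := rsqrt_gt0 v; have p2v := rsqrt_gt0 (2 * v).
have p1 := sqr_rsqrt v0; have p2 := sqr_rsqrt v20.
have vv : v * v^-1 = 1 by rewrite divff// gt_eqF.
have pp : rsqrt v <= 2 * rsqrt (2 * v).
  have vi : 0 < v^-1 by rewrite invr_gt0.
  rewrite -(@ler_pXn2r _ 2)//; last 2 first.
  - by rewrite nnegrE ltW.
  - by rewrite nnegrE mulr_ge0// ltW.
  by rewrite exprMn p1 p2 invfM; lra.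
pose t := u ^+ 2 / (4 * v).
have t0 : 0 <= t by rewrite divr_ge0 ?sqr_ge0// mulr_ge0// ltW.
have E1 : expR (- (u * rsqrt v) ^+ 2 / 2) = expR (- t) * expR (- t).
  rewrite -expRD; congr expR; rewrite exprMn p1 /t; field.
  by rewrite gt_eqF.
have E2 : expR (- (u * rsqrt (2 * v)) ^+ 2 / 2) = expR (- t).
  congr expR; rewrite exprMn p2 /t; field.
  by rewrite gt_eqF.
have te : t * expR (- t) <= 1.
  rewrite expRN ler_pdivrMr ?expR_gt0// mul1r.
  by have := expR_ge1Dx t; lra.
rewrite /heat /gauss E1 E2; set e := expR (- t) in te *.
have e0 : 0 < e := expR_gt0 _.
have d2 : delta ^+ 2 <= u ^+ 2.
  by rewrite -(real_normK (num_real u)) lerXn2r ?nnegrE// ltW.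
have u2 : u ^+ 2 = 4 * v * t by rewrite /t; field; rewrite gt_eqF.
apply: (@le_trans _ _ (rsqrt v * (e * e) * u ^+ 2)).
  by rewrite ler_wpM2l// !mulr_ge0// ltW.
rewrite u2 (_ : _ * (4 * v * t) = (4 * v * e * rsqrt v) * (t * e)); last by ring.
apply: (@le_trans _ _ (4 * v * e * rsqrt v)).
  by rewrite ler_piMr// !mulr_ge0// ltW.
rewrite (_ : 8 * v * _ = (4 * v * e) * (2 * rsqrt (2 * v))); last by ring.
by rewrite ler_wpM2l// !mulr_ge0// ltW.
Qed.

Lemma normal_prob_tail v m delta : 0 < v -> 0 < delta ->
  (normal_prob m (Num.sqrt v) [set x : K | (delta <= `|x - m|)%R] <=
   (8 * v / delta ^+ 2)%:E)%E.
Proof.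
move=> v0 d0; set A := [set x | _]; have v20 : 0 < 2 * v by rewrite mulr_gt0.
have mA : measurable A.
  rewrite (_ : A = setT `&` (fun x => `|x - m|) @^-1` `[delta, +oo[%classic).
    have : measurable_fun setT (fun x : K => `|x - m|).
      by apply: measurableT_comp => //; exact: measurable_funB.
    by apply.
  by apply/seteqP; split=> x /=; rewrite in_itv /= andbT; [split|case].
have c0 : 0 <= 8 * v / delta ^+ 2 by rewrite divr_ge0 ?mulr_ge0 ?exprn_ge0 ?ltW.
rewrite /normal_prob.
apply: (@le_trans _ _ (\int[leb]_(x in A) ((8 * v / delta ^+ 2)%:E
    * (normal_pdf m (Num.sqrt (2 * v)) x)%:E))%E).
  apply: ge0_le_integral => //.
  - by move=> x _; rewrite lee_fin normal_pdf_ge0.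
  - by apply/measurable_funTS/measurable_EFinP; exact: measurable_normal_pdf.
  - apply/measurable_funTS/emeasurable_funM => //.
    by apply/measurable_EFinP; exact: measurable_normal_pdf.
  move=> x /= dx; rewrite -EFinM lee_fin !normal_pdf_heat// [leRHS]mulrCA.
  by rewrite ler_pM2l ?gauss_cst_gt0//; exact: heat_tail.
rewrite ge0_integralZl//; last 2 first.
- by apply/measurable_funTS/measurable_EFinP; exact: measurable_normal_pdf.
- by move=> x _; rewrite lee_fin normal_pdf_ge0.
rewrite -[leRHS]mule1 lee_wpmul2l ?lee_fin//.
exact: (@probability_le1 _ _ _ (normal_prob m (Num.sqrt (2 * v))) A mA).
Qed.

(** The Radon-Nikodym derivative of the normal law agrees almost everywhere with the density, both
    having the same integrals over measurable sets. *)
Lemma normal_prob_mean v m (f : K -> K) a : 0 < v ->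
  mean (normal_prob m (Num.sqrt v)) f a -> (forall x, 0 <= f x) ->
  (\int[leb]_x (f x * (gauss_cst * heat v (x - m)))%:E = a%:E)%E.
Proof.
move=> v0 [fi <-] f0; set s := Num.sqrt v.
rewrite -(Radon_Nikodym_change_of_variables (normal_prob_dominates m s))//=.
have mf := measurable_int _ fi.
have mpdf : measurable_fun setT (fun x => (normal_pdf m s x)%:E).
  by apply/measurable_EFinP; exact: measurable_normal_pdf.
transitivity (\int[leb]_x ((f x)%:E * (normal_pdf m s x)%:E))%E.
  by apply: eq_integral => x _; rewrite normal_pdf_heat.
apply: ae_eq_integral => //.
- exact: emeasurable_funM.
- apply: emeasurable_funM => //; apply: (measurable_int leb).
  by apply: Radon_Nikodym_integrable; exact: normal_prob_dominates.
- apply: ae_eqe_mul2l => /=.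
  rewrite Radon_NikodymE//=; first exact: normal_prob_dominates.
  move=> nmu; case: cid => /= h [h1 h2 h3].
  apply: integral_ae_eq => //=.
  + exact: integrable_normal_pdf.
  + exact: (measurable_int leb).
  + by move=> E _ mE; rewrite -h3.
Qed.

(** The indicator confines the pointwise error to a segment of length 2 L, so that a uniform bound
    survives integration against Lebesgue measure. *)
Lemma lebesgue_mean_close (g h : K -> K) (a b B L : K) :
  measurable_fun setT g -> measurable_fun setT h ->
  (forall m, 0 <= g m) -> (forall m, 0 <= h m) -> 0 <= B -> 0 < L ->
  (forall m, `|g m - h m| <= B * \1_(`[- L, L]%classic) m) ->
  (\int[leb]_m (g m)%:E = a%:E)%E -> (\int[leb]_m (h m)%:E = b%:E)%E ->
  `|a - b| <= B * (2 * L).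
Proof.
move=> mg mh g0 h0 B0 L0 gh ga hb.
have LL : - L < L by lra.
have key (g' h' : K -> K) a' b' : measurable_fun setT g' -> measurable_fun setT h' ->
    (forall m, 0 <= g' m) -> (forall m, 0 <= h' m) ->
    (forall m, g' m <= h' m + B * \1_(`[- L, L]%classic) m) ->
    (\int[leb]_m (g' m)%:E = a'%:E)%E -> (\int[leb]_m (h' m)%:E = b'%:E)%E ->
    a' <= b' + B * (2 * L).
  move=> mg' mh' g'0 h'0 gh' ga' hb'; rewrite -lee_fin -ga' EFinD -hb'.
  have -> : (B * (2 * L))%:E =
      (\int[leb]_m (B%:E * (\1_(`[- L, L]%classic) m)%:E))%E.
    rewrite [RHS](@ge0_integralZl _ _ _ leb _ measurableT
      (fun m => (\1_(`[- L, L]%classic) m)%:E)); last 3 first.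
    - by apply/measurable_EFinP; exact: measurable_indic.
    - by move=> m _; rewrite lee_fin.
    - by rewrite lee_fin.
    have -> : (\int[leb]_m (\1_(`[- L, L]%classic) m)%:E = (2 * L)%:E)%E.
      transitivity (leb (`[- L, L]%classic `&` setT)).
        exact: (@integral_indic _ (measurableTypeR K) K leb setT measurableT _
          (measurable_itv _)).
      rewrite setIT lebesgue_measure_itv /= lte_fin LL -EFinB.
      by congr (_%:E); ring.
    by rewrite EFinM.
  rewrite -ge0_integralD//; first last.
  - by apply: emeasurable_funM => //; apply/measurable_EFinP; exact: measurable_indic.
  - by move=> m _; rewrite mule_ge0 ?lee_fin.
  - exact/measurable_EFinP.
  - by move=> m _; rewrite lee_fin.
  apply: ge0_le_integral => //.
  - by move=> m _; rewrite lee_fin.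
  - exact/measurable_EFinP.
  - apply: emeasurable_funD; first exact/measurable_EFinP.
    by apply: emeasurable_funM => //; apply/measurable_EFinP; exact: measurable_indic.
  - by move=> m _; rewrite -EFinM -EFinD lee_fin.
rewrite ler_norml; apply/andP; split.
  suff : b <= a + B * (2 * L) by lra.
  apply: key hb ga => // m; have := gh m; rewrite ler_norml => /andP[]; lra.
suff : a <= b + B * (2 * L) by lra.
by apply: key ga hb => // m; have := gh m; rewrite ler_norml => /andP[]; lra.
Qed.

End normal_heat.

(** * From heat kernels to a continuous test function *)

Section mollification.
Context {K : realType} {disp} {T : measurableType disp} (P : probability T K).
Context (X : T -> K) (V s2 tau M L delta omega e C : K) (f : K -> K).
Hypothesis mX : measurable_fun setT X.
Hypothesis X2 : mean P (fun w => X w ^+ 2) V.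
Hypotheses (s20 : 0 < s2) (tau0 : 0 < tau) (L0 : 0 < L) (delta0 : 0 < delta).
Hypotheses (deltaL : delta <= L) (V0 : s2 / 2 <= tau + V) (C0 : 0 <= C).
Hypothesis mf : measurable_fun setT f.
Hypotheses (f0 : forall x, 0 <= f x) (fM : forall x, f x <= M).
Hypothesis fcont : forall x y, `|x| <= 2 * L -> `|y| <= 2 * L ->
  `|x - y| < delta -> `|f x - f y| <= omega.
Hypothesis heatX : forall m, exists2 q, mean P (fun w => heat tau (X w - m)) q &
  `|q - heat (tau + V) (- m)| <= e.
Hypothesis heatC : forall v w x, s2 / 2 <= v -> s2 / 2 <= w ->
  `|heat v x - heat w x| <= C * `|v - w|.

(** The cutoff is at 2 L while the variable is compared on [- L, L]: since delta <= L, points within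
    delta of the latter are not cut off. *)
Let f1 m := f m * \1_(`[- (2 * L), 2 * L]%classic) m.

Let ind_le1 (A : set K) x : 0 <= (\1_A x : K) <= 1.
Proof. by rewrite indicE ler0n -[1]/(1%:R) ler_nat leq_b1. Qed.

Let f1_ge0 m : 0 <= f1 m.
Proof. by rewrite /f1 mulr_ge0//; case/andP: (ind_le1 `[- (2 * L), 2 * L]%classic m). Qed.

Let f1_leM m : f1 m <= M.
Proof.
have /andP[h0 h1] := ind_le1 `[- (2 * L), 2 * L]%classic m.
by rewrite /f1; apply: le_trans (fM m); rewrite ler_piMr.
Qed.

Let mf1 : measurable_fun setT f1.
Proof. by apply: measurable_funM => //; exact: measurable_indic. Qed.

Let f1E m : `|m| <= 2 * L -> f1 m = f m.
Proof.
by move=> mL; rewrite /f1 indicE mem_set ?mulr1//= in_itv /= -ler_norml.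
Qed.

Let M0 : 0 <= M. Proof. exact: le_trans (f0 0) (fM 0). Qed.

Let tailset r y : set K := [set x : K | (r <= `|x - y|)%R].

Let mtail r y : measurable (tailset r y).
Proof.
rewrite (_ : tailset r y = setT `&` (fun x => `|x - y|) @^-1` `[r, +oo[%classic).
  have : measurable_fun setT (fun x : K => `|x - y|).
    by apply: measurableT_comp => //; exact: measurable_funB.
  by apply.
by apply/seteqP; split=> x /=; rewrite /tailset /= in_itv /= andbT; [split|case].
Qed.

Let omega0 : 0 <= omega.
Proof.
by apply: le_trans (@fcont 0 0 _ _ _); rewrite ?normr0 ?subr0 ?normr0// mulr_ge0// ltW.
Qed.

(** Three regimes: |y| > L, paid by y^2 / L^2; m at distance at least delta from y, paid by the
    Gaussian tail; otherwise the modulus of continuity [omega]. *)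
Let close y m : `|f y - f1 m| <=
  omega + M * \1_(tailset delta y) m + M * (y ^+ 2 / L ^+ 2).
Proof.
have yL0 : 0 <= M * (y ^+ 2 / L ^+ 2).
  by rewrite mulr_ge0// divr_ge0 ?sqr_ge0.
have /andP[i0 i1] := ind_le1 (tailset delta y) m.
have Mi : 0 <= M * \1_(tailset delta y) m by rewrite mulr_ge0.
have crude : `|f y - f1 m| <= M.
  have := f1_ge0 m; have := f1_leM m; have := f0 y; have := fM y.
  by rewrite ler_norml => *; lra.
have [yL|yL] := leP `|y| L; last first.
  suff h : M <= M * (y ^+ 2 / L ^+ 2).
    by apply: (le_trans crude); apply: (le_trans h); rewrite lerDr addr_ge0.
  rewrite ler_peMr// ler_pdivlMr ?exprn_gt0// mul1r.
  by rewrite -(real_normK (num_real y)) lerXn2r ?nnegrE// ltW.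
have [ym|ym] := leP delta `|m - y|.
  rewrite indicE (_ : m \in tailset delta y); first by
    rewrite mulr1; apply: (le_trans crude); rewrite -addrA addrCA lerDl addr_ge0.
  by rewrite inE.
have mL : `|m| <= 2 * L.
  have := ler_normD (m - y) y; rewrite subrK => h; apply: (le_trans h).
  rewrite mulr_natl mulr2n; apply: lerD => //.
  exact: ltW (lt_le_trans ym deltaL).
rewrite f1E//; have h : `|f y - f m| <= omega.
  apply: fcont => //; last by rewrite distrC.
  by apply: (le_trans yL); rewrite mulr_natl mulr2n lerDl ltW.
by apply: (le_trans h); rewrite -addrA lerDl addr_ge0.
Qed.

Let tail_mean r y v : 0 < v -> 0 < r ->
  exists2 a, mean (normal_prob y (Num.sqrt v)) (\1_(tailset r y)) a &
    a <= 8 * v / r ^+ 2.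
Proof.
move=> v0 r0; set N := normal_prob y (Num.sqrt v).
have [||a ha _] := @mean_bounded _ _ _ N (\1_(tailset r y)) 1.
- exact: (measurable_indic (mtail r y)).
- move=> x; have /andP[h0 h1] := ind_le1 (tailset r y) x.
  by rewrite ger0_norm.
exists a => //; rewrite -lee_fin -ha.2.
have -> : (\int[N]_x (\1_(tailset r y) x)%:E = N (tailset r y))%E.
  rewrite -[in RHS](setIT (tailset r y)).
  exact: (@integral_indic _ (measurableTypeR K) K N setT measurableT _
    (mtail r y)).
exact: normal_prob_tail.
Qed.

Let f1_mean (N : probability (measurableTypeR K) K) : exists a, mean N f1 a.
Proof.
have [||a ha _] := @mean_bounded _ _ _ N f1 M; [by []| |by exists a].
by move=> x; rewrite ger0_norm ?f1_leM ?f1_ge0.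
Qed.

Let e0 : 0 <= e.
Proof. by have [q _] := heatX 0; apply: le_trans. Qed.

(** With [J] the average of [f1] under N(y, tau), the chain of approximations is E f(X), E J(X), the
    integral over m of [f1] against the density of N(0, s2), and finally E f under that law. The
    three lines of the bound correspond to the three passages. *)
Lemma mollify : exists a b, [/\ mean P (fun w => f (X w)) a,
  mean (centered_normal s2) f b &
  `|a - b| <= (omega + M * (8 * tau / delta ^+ 2) + M * (V / L ^+ 2))
    + (M * (gauss_cst * (e + C * `|tau + V - s2|))) * (2 * (2 * L))
    + M * (8 * s2 / (2 * L) ^+ 2)].
Proof.
have k0 : 0 < gauss_cst :> K := gauss_cst_gt0.
have [J hJ] := choice (fun y => f1_mean (normal_prob y (Num.sqrt tau))).
pose G (y m : K) := f1 m * (gauss_cst * heat tau (m - y)).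
have G0 y m : 0 <= G y m.
  by rewrite /G mulr_ge0// mulr_ge0 ?ltW ?heat_gt0.
have JG y : (\int[lebesgue_measure]_m (G y m)%:E = (J y)%:E)%E.
  exact: normal_prob_mean tau0 (hJ y) f1_ge0.
have mG2 : measurable_fun setT (fun p : T * K => (G (X p.1) p.2)%:E).
  apply/measurable_EFinP; apply: measurable_funM.
    exact: (measurableT_comp mf1).
  apply: measurable_funM => //; apply: (measurableT_comp (measurable_heat tau)).
  apply: measurable_funB => //; exact: (measurableT_comp mX).
have G20 (p : T * K) : (0 <= (G (X p.1) p.2)%:E)%E by rewrite lee_fin.
have mJ : measurable_fun setT (fun w => J (X w)).
  apply/measurable_EFinP.
  have := @measurable_fun_fubini_tonelli_F _ _ _ _ _ (@lebesgue_measure K) _ mG2 G20.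
  rewrite (_ : fubini_F _ _ = EFin \o (fun w => J (X w)))//.
  by apply/funext => w; rewrite /fubini_F /= JG.
have fJ y : `|f y - J y| <= omega + M * (8 * tau / delta ^+ 2) + M * (y ^+ 2 / L ^+ 2).
  have [t ht tb] := tail_mean y tau0 delta0.
  have h1 := meanB (mean_cst (normal_prob y (Num.sqrt tau)) (f y)) (hJ y).
  have h2 := meanD (meanD (mean_cst _ omega) (meanZ M ht))
    (mean_cst _ (M * (y ^+ 2 / L ^+ 2))).
  have [z hz zb] := mean_le_exists (mean_measurable h1) (close y) h2.
  rewrite (mean_uniq hz h1) in zb; apply: le_trans zb _.
  by rewrite lerD2r lerD2l ler_wpM2l.
have mfX : measurable_fun setT (fun w => f (X w)) by exact: measurableT_comp.
have [||a ha _] := @mean_bounded _ _ _ P (fun w => f (X w)) M; [by []| |].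
  by move=> w; rewrite ger0_norm.
have hbd := meanD (mean_cst P (omega + M * (8 * tau / delta ^+ 2)))
  (meanZ (M / L ^+ 2) X2).
have [||z hz zb] := @mean_le_exists _ _ _ P (fun w => f (X w) - J (X w))
  _ _ _ _ hbd.
- exact: (measurable_funB mfX mJ).
- by move=> w; apply: le_trans (fJ (X w)) _; rewrite lerD2l mulrA mulrAC.
have hJX : mean P (fun w => J (X w)) (a - z).
  by apply: mean_ext (meanB ha hz) => w; ring.
have [q hq] := choice (fun m => let: ex_intro2 q h1 h2 := heatX m in
  ex_intro (fun q => mean P (fun w => heat tau (X w - m)) q /\
    `|q - heat (tau + V) (- m)| <= e) q (conj h1 h2)).
(* By symmetry the kernel centred at X and evaluated at m is the kernel centred at m and evaluated
   at X, which is what [heatX] controls. *)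
have inner m : (\int[P]_w (G (X w) m)%:E = (f1 m * (gauss_cst * q m))%:E)%E.
  have [h _] := hq m.
  have /(meanZ (f1 m * gauss_cst))[_] := h.
  rewrite -mulrA => <-; apply: eq_integral => w _; congr (_%:E).
  by rewrite /G -[m - _]opprB heatN mulrA.
have gint : (\int[lebesgue_measure]_m (f1 m * (gauss_cst * q m))%:E = (a - z)%:E)%E.
  rewrite -hJX.2.
  transitivity (\int[P]_w \int[lebesgue_measure]_m (G (X w) m)%:E)%E; last first.
    by apply: eq_integral => w _; rewrite JG.
  rewrite (@fubini_tonelli _ _ _ _ _ P (@lebesgue_measure K) _ mG2 G20).
  by apply: eq_integral => m _; rewrite inner.
have [b1 hb1] := f1_mean (normal_prob 0 (Num.sqrt s2)).
have hint := normal_prob_mean s20 hb1 f1_ge0.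
have q0 m : 0 <= q m.
  by apply: mean_ge0 (hq m).1 => w; rewrite ltW ?heat_gt0.
have mg : measurable_fun setT (fun m => f1 m * (gauss_cst * q m)).
  apply/measurable_EFinP.
  have := @measurable_fun_fubini_tonelli_G _ _ _ _ _ P _ mG2 G20.
  rewrite (_ : fubini_G _ _ = EFin \o (fun m => f1 m * (gauss_cst * q m)))//.
  by apply/funext => m; rewrite /fubini_G /= inner.
have L20 : 0 < 2 * L by rewrite mulr_gt0.
have ab1 : `|(a - z) - b1| <=
    (M * (gauss_cst * (e + C * `|tau + V - s2|))) * (2 * (2 * L)).
  apply: lebesgue_mean_close mg _ _ _ _ L20 _ gint hint.
  - apply: measurable_funM => //; apply: measurable_funM => //.
    by apply: (measurableT_comp (measurable_heat s2)); exact: measurable_funB.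
  - by move=> m; rewrite mulr_ge0// mulr_ge0// ltW.
  - by move=> m; rewrite mulr_ge0// mulr_ge0// ?ltW ?heat_gt0.
  - apply: mulr_ge0 => //; apply: mulr_ge0; first exact: ltW.
    by apply: addr_ge0 => //; exact: mulr_ge0.
  move=> m; have /andP[i0 _] := ind_le1 `[- (2 * L), 2 * L]%classic m.
  rewrite -mulrBr -mulrBr subr0 normrM (ger0_norm (f1_ge0 m)) normrM (gtr0_norm k0).
  rewrite {1}/f1 mulrAC; apply: ler_wpM2r => //.
  apply: ler_pM => //; first by rewrite mulr_ge0// ltW.
  rewrite ler_pM2l//.
  have [_ h1] := hq m.
  have s22 : s2 / 2 <= s2 by rewrite ler_pdivrMr// mulr_natr mulr2n lerDl ltW.
  have h2 := @heatC (tau + V) s2 (- m) V0 s22.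
  rewrite -(heatN s2) (_ : q m - _ = (q m - heat (tau + V) (- m))
    + (heat (tau + V) (- m) - heat s2 (- m))); last by ring.
  exact: le_trans (ler_normD _ _) (lerD h1 h2).
have [||b hb _] := @mean_bounded _ _ _ (centered_normal s2) f M; [by []| |].
  by move=> x; rewrite ger0_norm.
have bb1 : `|b - b1| <= M * (8 * s2 / (2 * L) ^+ 2).
  have [t ht tb] := tail_mean 0 s20 L20.
  have h1 := meanB hb hb1.
  have [|y hy yb] := mean_le_exists (mean_measurable h1) _ (meanZ M ht).
  - move=> x; have /andP[i0 i1] := ind_le1 (tailset (2 * L) 0) x.
    have [xL|xL] := leP (2 * L) `|x|.
      rewrite indicE mem_set ?mulr1; last by rewrite /tailset /= subr0.
      have := f1_ge0 x; have := f1_leM x; have := f0 x; have := fM x.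
      by rewrite ler_norml => *; lra.
    rewrite f1E; last exact: ltW.
    by rewrite subrr normr0; apply: mulr_ge0.
  rewrite (mean_uniq hy h1) in yb; apply: le_trans yb _.
  by rewrite ler_wpM2l.
exists a, b; split => //.
rewrite (_ : a - b = z + ((a - z) - b1) - (b - b1)); last by ring.
apply: le_trans (ler_normB _ _) _; apply: lerD => //.
apply: le_trans (ler_normD _ _) _; apply: lerD => //.
by apply: le_trans zb _; rewrite lerD2l [leRHS]mulrA [leRHS]mulrAC.
Qed.

End mollification.

(** * Convergence in distribution from heat kernel tests *)

Section weak_convergence.
Context {K : realType} {disp} {T : measurableType disp} (P : probability T K).

Lemma uniform_continuity_segment (f : K -> K) A omega : continuous f -> 0 < omega ->
  exists2 delta, 0 < delta &
    forall x y, `|x| <= A -> `|x - y| < delta -> `|f x - f y| <= omega.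
Proof.
move=> cf om0.
have /compact_near_coveringP cA := @segment_compact K (- A) A.
pose Q (delta x : K) := forall y, `|x - y| < delta -> `|f x - f y| <= omega.
have := cA _ (0^'+ : set_system K) Q _ => /(_ _)[].
  move=> x _.
  have om2 : 0 < omega / 2 by rewrite divr_gt0.
  have /cvgrPdist_lt /(_ _ om2) /nbhs_ballP[eta /= eta0 feta] := cf x.
  exists (ball x (eta / 2), [set delta | 0 < delta < eta / 2]).
    split => /=; first by apply: nbhsx_ballx; rewrite divr_gt0.
    have h : 0 < eta / 2 by rewrite divr_gt0.
    near=> delta; apply/andP; split; first by near: delta; exact: nbhs_right_gt.
    by near: delta; exact: nbhs_right_lt.
  move=> [x' delta] /= [xx' /andP[_ de]] y x'y.
  have fx' : `|f x - f x'| < omega / 2.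
    by apply: feta; apply: le_ball xx'; lra.
  have fy : `|f x - f y| < omega / 2.
    apply: feta; rewrite /ball /=; rewrite /ball /= in xx'.
    rewrite (_ : x - y = (x - x') + (x' - y)); last by ring.
    by apply: le_lt_trans (ler_normD _ _) _; lra.
  rewrite (_ : f x' - f y = (f x - f y) - (f x - f x')); last by ring.
  by apply: le_trans (ler_normB _ _) _; lra.
move=> delta /= d0 h; exists (delta / 2); first by rewrite divr_gt0.
move=> x y xA xy; apply: (h (delta / 2)) => //.
- by rewrite /ball /= sub0r normrN gtr0_norm ?divr_gt0//; lra.
- by rewrite divr_gt0.
- by rewrite /= in_itv /= -ler_norml.
Unshelve. all: by end_near.
Qed.

Lemma weak_cvg_heat (X : nat -> T -> K) (V : nat -> K) (s2 : K) : 0 < s2 ->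
  (\forall d \near \oo, measurable_fun setT (X d) /\
     mean P (fun w => X d w ^+ 2) (V d)) ->
  V @ \oo --> s2 ->
  (forall tau e, 0 < tau -> 0 < e -> \forall d \near \oo, forall m,
    exists2 q, mean P (fun w => heat tau (X d w - m)) q &
      `|q - heat (tau + V d) (- m)| <= e) ->
  cvg_in_distribution P X (centered_normal s2).
Proof.
move=> s20 mX Vs2 hX f cf bf.
have [B fB] : exists B, forall x, `|f x| <= B.
  have [B [_ hB]] := bf; exists (B + 1) => x.
  by apply: (hB (B + 1)) => //; rewrite ltrDl.
have mf : measurable_fun setT f by exact: continuous_measurable_fun.
have [b hb _] := @mean_bounded _ _ _ (centered_normal s2) f B mf fB.
pose a d := fine ('E_P[f \o X d])%E.
have hEa d : measurable_fun setT (X d) -> mean P (fun w => f (X d w)) (a d).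
  move=> mXd; have [||z hz _] := @mean_bounded _ _ _ P (fun w => f (X d w)) B.
  - exact: measurableT_comp.
  - by move=> w.
  suff -> : a d = z by [].
  by rewrite /a unlock hz.2.
suff ab : a @ \oo --> b.
  rewrite hb.2; apply: cvg_EFin; last exact: ab.
  near=> d.
  have [mXd _] : measurable_fun setT (X d) /\ mean P (fun w => X d w ^+ 2) (V d).
    by near: d.
  by rewrite unlock (hEa d mXd).2.
apply/cvgrPdist_le => eps0' eps0'0.
(* Seven errors of size [eps] are collected at the end. *)
pose eps := eps0' / 8.
have eps0 : 0 < eps by rewrite divr_gt0.
(* [mollify] works with nonnegative functions, so [f] is shifted by its bound and the shift is
   removed from both means. *)
pose g x := f x + B.
pose M := 2 * B + 1.
have B0 : 0 <= B by exact: le_trans (fB 0).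
have g0 x : 0 <= g x by have := fB x; rewrite ler_norml /g => /andP[]; lra.
have gM x : g x <= M by have := fB x; rewrite ler_norml /g /M => /andP[]; lra.
have M0 : 0 < M by rewrite /M; lra.
have mg : measurable_fun setT g by exact: measurable_funD.
(* Chosen so that 2 M s2 / L^2 <= eps; this covers the tails of X (whose second moment is eventually
   at most 2 s2) and those of the limit law. *)
pose L := 1 + 2 * M * s2 / eps.
have Ls0 : 0 <= 2 * M * s2 / eps by rewrite divr_ge0// ?mulr_ge0// ltW.
have L0 : 0 < L by rewrite /L; lra.
have Lb : M * (2 * s2 / L ^+ 2) <= eps.
  rewrite mulrA ler_pdivrMr ?exprn_gt0// mulrA (mulrC M).
  have h : 2 * M * s2 = 2 * M * s2 / eps * eps by rewrite divfK ?gt_eqF.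
  have L1 : 1 <= L by rewrite /L; lra.
  rewrite h mulrC ler_pM2l//; rewrite /L in L1 *.
  set u := 2 * M * s2 / eps in Ls0 L1 *; nra.
have [delta1 d10 hd1] := uniform_continuity_segment (2 * L) cf eps0.
pose delta := Num.min delta1 L.
have delta0 : 0 < delta by rewrite lt_min d10.
have deltaL : delta <= L by rewrite ge_min lexx orbT.
have gcont x y : `|x| <= 2 * L -> `|y| <= 2 * L -> `|x - y| < delta ->
    `|g x - g y| <= eps.
  move=> xL _ xy; rewrite /g (_ : _ - _ = f x - f y); last by ring.
  by apply: hd1 => //; apply: lt_le_trans xy _; rewrite ge_min lexx.
have s22 : 0 < s2 / 2 by rewrite divr_gt0.
have [C C0 hC] := heat_lip s22.
have k0 : 0 < gauss_cst :> K := gauss_cst_gt0.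
pose Q := M * gauss_cst * (2 * (2 * L)).
have Q0 : 0 < Q by rewrite /Q !mulr_gt0.
(* [W] dominates each coefficient of [tau] in the remaining errors. It depends on L and delta, so
   [tau] is chosen last; [tau] also serves as the accuracy required of the heat kernel means. *)
pose W := 8 * M / delta ^+ 2 + Q * C + Q + 1.
have W1 : 0 <= 8 * M / delta ^+ 2 by rewrite divr_ge0 ?mulr_ge0 ?sqr_ge0 ?ltW.
have QC0 : 0 < Q * C by rewrite mulr_gt0.
have W0 : 0 < W by rewrite /W; lra.
pose tau := eps / W.
have tau0 : 0 < tau by rewrite divr_gt0.
have Wt : W * tau = eps by rewrite /tau mulrC divfK ?gt_eqF.
have t1 : 8 * M / delta ^+ 2 * tau <= eps.
  by rewrite -Wt ler_pM2r// /W; lra.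
have t2 : Q * C * tau <= eps by rewrite -Wt ler_pM2r// /W; lra.
have t3 : Q * tau <= eps by rewrite -Wt ler_pM2r// /W; lra.
near=> d.
have [mXd X2d] : measurable_fun setT (X d) /\ mean P (fun w => X d w ^+ 2) (V d).
  by near: d.
have Vd : `|s2 - V d| <= Num.min tau (s2 / 2).
  by near: d; move/cvgrPdist_le : Vs2; apply; rewrite lt_min tau0.
have /andP[V1 V2] : (`|s2 - V d| <= tau) && (`|s2 - V d| <= s2 / 2).
  by rewrite -le_min.
have /andP[V3 V4] : (s2 / 2 <= V d) && (V d <= 2 * s2).
  by move: V2; rewrite ler_norml => /andP[? ?]; apply/andP; split; lra.
have heatd : forall m, exists2 q, mean P (fun w => heat tau (X d w - m)) q &
      `|q - heat (tau + V d) (- m)| <= tau.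
  by near: d; exact: hX.
have V5 : s2 / 2 <= tau + V d by lra.
have [a' [b' [ha' hb' ab']]] := mollify mXd X2d s20 tau0 L0 delta0 deltaL V5
  (ltW C0) mg g0 gM gcont heatd hC.
have aE : a d = a' - B.
  apply: mean_uniq (hEa d mXd) _.
  by apply: mean_ext (meanB ha' (mean_cst P B)) => w; rewrite /g addrK.
have bE : b = b' - B.
  apply: mean_uniq hb _.
  by apply: mean_ext (meanB hb' (mean_cst _ B)) => w; rewrite /g addrK.
rewrite aE bE distrC (_ : _ - _ = a' - b'); last by ring.
apply: (le_trans ab').
have u1 : M * (8 * tau / delta ^+ 2) <= eps.
  by apply: le_trans t1; rewrite le_eqVlt; apply/orP; left; apply/eqP; ring.
have u2 : M * (V d / L ^+ 2) <= eps.
  apply: le_trans Lb; rewrite ler_pM2l// ler_pM2r ?invr_gt0 ?exprn_gt0//.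
have u3 : M * (8 * s2 / (2 * L) ^+ 2) <= eps.
  apply: le_trans Lb; rewrite le_eqVlt; apply/orP; left; apply/eqP.
  by field; rewrite gt_eqF.
have u4 : M * (gauss_cst * (tau + C * `|tau + V d - s2|)) * (2 * (2 * L)) <=
    3 * eps.
  have h : `|tau + V d - s2| <= 2 * tau.
    rewrite (_ : _ - s2 = tau - (s2 - V d)); last by ring.
    apply: le_trans (ler_normB _ _) _; rewrite gtr0_norm//; lra.
  have h2 : Q * (C * `|tau + V d - s2|) <= 2 * (Q * C * tau).
    rewrite (_ : 2 * _ = Q * (C * (2 * tau))); last by ring.
    by rewrite ler_pM2l// ler_pM2l.
  rewrite (_ : _ * (2 * (2 * L)) = Q * tau + Q * (C * `|tau + V d - s2|)).
    by lra.
  by rewrite /Q; ring.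
have : eps0' = 8 * eps by rewrite /eps; field.
by lra.
Unshelve. all: by end_near.
Qed.

End weak_convergence.

(** * Smallness of the accumulated error *)

Section clt_bounds.
Context {K : realType}.

(** In terms of a = N^2 / (D c^2), b = N V / c^2 and s = sig / c^2, all controlled by Lam, the sum
    of N step errors becomes small as N and D grow and [eta], [eps] and N * gam shrink, whatever the
    ratio N / D. *)
Lemma step_bound_le (N D c V m4 eps gam Lam eta sig : K) :
  0 < N -> 1 <= D -> 0 < c -> 0 <= V -> 0 < eps -> 0 < eta -> 0 <= sig -> 0 <= m4 ->
  N * V + 2 * N ^+ 2 / D <= Lam * c ^+ 2 -> sig <= Lam * c ^+ 2 ->
  N * ((c + sig / c) / (D * c ^+ 2) + 8 * gam + 16 * eps * N / (D * c ^+ 2)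
    + 192 * m4 * (N ^+ 2 + sig) / (D ^+ 2 * c ^+ 4 * eps)
    + ((V + 4 * N / D) / c ^+ 2) ^+ 2)
  <= (1 + Lam) * (eta + Lam / (D * eta)) + 8 * (N * gam) + 8 * eps * Lam
    + (192 * m4 / eps * Lam ^+ 2 + 9 * Lam ^+ 2) / N.
Proof.
move=> N0 D1 c0 V0 eps0 eta0 sig0 m40 hL hsig.
have D0 : 0 < D by lra.
have [NN DN cN eN tN] : [/\ N != 0, D != 0, c != 0, eps != 0 & eta != 0].
  by split; rewrite gt_eqF.
have c20 : 0 < c ^+ 2 by rewrite exprn_gt0.
pose a := N ^+ 2 / (D * c ^+ 2); pose b := N * V / c ^+ 2.
pose s := sig / c ^+ 2; pose x := N / (D * c).
have a0 : 0 <= a by rewrite /a divr_ge0 ?sqr_ge0// mulr_ge0 ?ltW.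
have b0 : 0 <= b by apply: divr_ge0; [rewrite mulr_ge0// ltW|exact: ltW].
have s0 : 0 <= s by apply: divr_ge0 => //; exact: ltW.
have ab : b + 2 * a <= Lam.
  rewrite (_ : b + 2 * a = (N * V + 2 * N ^+ 2 / D) / c ^+ 2); last first.
    by rewrite /a /b; field; rewrite cN DN.
  by rewrite ler_pdivrMr.
have sL : s <= Lam by rewrite /s ler_pdivrMr.
have L0 : 0 <= Lam by exact: le_trans sL.
have x0 : 0 <= x by rewrite /x divr_ge0 ?mulr_ge0 ?ltW.
(* Here x^2 = a / D, so x is small for large D; [eta] avoids a square root. *)
have xx : 2 * x <= eta + a / (D * eta).
  rewrite (_ : eta + a / (D * eta) = 2 * x + (x - eta) ^+ 2 / eta); last first.
    by rewrite /a /x; field; rewrite cN DN tN.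
  by rewrite lerDl divr_ge0 ?sqr_ge0 ?ltW.
have aLD : a / (D * eta) <= Lam / (D * eta).
  by rewrite ler_pM2r ?invr_gt0 ?mulr_gt0//; lra.
have t1 : x * (1 + s) <= (1 + Lam) * (eta + Lam / (D * eta)).
  rewrite mulrC; apply: ler_pM => //; [lra|lra|].
  by lra.
have N1 : 0 < N^-1 by rewrite invr_gt0.
have t4 : 192 * m4 / eps * (a ^+ 2 / N + s * a / (D * N)) <=
    192 * m4 / eps * Lam ^+ 2 / N.
  rewrite -[leRHS]mulrA; apply: ler_wpM2l.
    by apply: divr_ge0; [rewrite mulr_ge0|exact: ltW].
  have h1 : s * a / (D * N) <= s * a / N.
    apply: ler_wpM2l; first exact: mulr_ge0.
    by rewrite lef_pV2 ?posrE ?mulr_gt0// ler_peMl// ltW.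
  apply: (le_trans (lerD (lexx _) h1)); rewrite -mulrDl ler_pM2r//.
  by nra.
have t5 : (b + 4 * a) ^+ 2 / N <= 9 * Lam ^+ 2 / N.
  rewrite ler_pM2r//; have h : b + 4 * a <= 3 * Lam by lra.
  have h0 : 0 <= b + 4 * a by lra.
  by nra.
have t3 : 16 * eps * a <= 8 * eps * Lam by nra.
rewrite (_ : N * _ = x * (1 + s) + 8 * (N * gam) + 16 * eps * a
  + 192 * m4 / eps * (a ^+ 2 / N + s * a / (D * N)) + (b + 4 * a) ^+ 2 / N);
  last first.
  by rewrite /x /s /a /b; field; rewrite cN DN eN NN.
rewrite mulrDl; lra.
Qed.

Context {disp} {T : measurableType disp} (P : probability T K).

(** c^2 [cut_cube (Y / c)] is min (Y^2, |Y|^3 / c), which is dominated by Y^2 and tends to 0 as c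
    grows. Dominated convergence along integers yields one k, and monotonicity in c covers all c >=
    k. *)
Lemma cut_cube_mean (Y : T -> K) v : measurable_fun setT Y ->
  mean P (fun w => Y w ^+ 2) v -> forall eta, 0 < eta ->
  exists2 k, 0 < k & forall c, k <= c ->
    exists2 g, mean P (fun w => cut_cube (Y w / c)) g & g <= eta / c ^+ 2.
Proof.
move=> mY Y2 eta eta0.
pose psi (k : K) w := Num.min (Y w ^+ 2) (`|Y w| ^+ 3 / k).
have mpsi k : measurable_fun setT (psi k).
  apply: measurable_minr; first exact: measurable_funX.
  apply: measurable_funM => //; apply: measurable_funX.
  exact: measurableT_comp.
have psi0 k w : 0 < k -> 0 <= psi k w.
  by move=> k0; rewrite /psi le_min sqr_ge0 divr_ge0 ?exprn_ge0// ltW.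
have psiY k w : psi k w <= Y w ^+ 2 by rewrite /psi ge_min lexx.
have lim0 : (\int[P]_w (psi k.+1%:R w)%:E @[k --> \oo] --> 0)%E.
  rewrite (_ : 0%E = \int[P]_w (cst 0%E w))%E; last by rewrite integral0.
  have [| | | ||_ _] := @dominated_convergence _ _ _ P setT measurableT
      (fun k w => (psi k.+1%:R w)%:E) (cst 0%E) (fun w => (Y w ^+ 2)%:E).
  - by move=> k; exact/measurable_EFinP.
  - exact: measurable_cst.
  - apply: aeW => w _; apply: cvg_EFin; first exact: nearW.
    apply: (@squeeze_cvgr _ _ _ _ (cst 0) (fun k => `|Y w| ^+ 3 / k.+1%:R)).
    + by apply: nearW => k; rewrite /= psi0// /psi ge_min lexx orbT.
    + exact: cvg_cst.
    + rewrite -(mulr0 (`|Y w| ^+ 3)); apply: cvgMr.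
      exact: cvg_harmonic.
  - exact: Y2.1.
  - by apply: aeW => w k _; rewrite /= lee_fin ger0_norm ?psi0.
  - by [].
have [k gk] : exists k, fine (\int[P]_w (psi k.+1%:R w)%:E)%E < eta.
  have h : \forall k \near \oo, fine (\int[P]_w (psi k.+1%:R w)%:E)%E < eta.
    exact: (cvgr_lt _ (fine_cvg lim0)).
  by have [k _ hk] := h; exists k; apply: hk => /=.
exists k.+1%:R => // c kc.
have k0 : 0 < k.+1%:R :> K by [].
have c0 : 0 < c by exact: lt_le_trans kc.
have psin w : `|psi k.+1%:R w| <= Y w ^+ 2 by rewrite ger0_norm ?psi0.
have [z hz _] := mean_le_exists (mpsi k.+1%:R) psin Y2.
have ze : z <= eta by rewrite hz.2 in gk; exact: ltW.
have bd w : `|cut_cube (Y w / c)| <= (c ^+ 2)^-1 * psi k.+1%:R w.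
  rewrite ger0_norm ?cut_cube_ge0// /cut_cube /psi.
  have ci : 0 < (c ^+ 2)^-1 by rewrite invr_gt0 exprn_gt0.
  rewrite (minr_pMr _ _ (ltW ci)) le_min !ge_min.
  rewrite expr_div_n mulrC lexx /= normrM exprMn.
  apply/orP; right; rewrite normfV (gtr0_norm c0).
  rewrite (_ : c^-1 ^+ 3 = (c ^+ 2)^-1 * c^-1); last by rewrite exprSr exprVn.
  rewrite mulrC -mulrA ler_pM2l// mulrC ler_wpM2l ?exprn_ge0//.
  by rewrite lef_pV2 ?posrE.
have [||g hg gb] := @mean_le_exists _ _ _ P (fun w => cut_cube (Y w / c)) _ _ _ _
  (meanZ (c ^+ 2)^-1 hz).
- apply: (measurableT_comp measurable_cut_cube); exact: measurable_funM.
- exact: bd.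
exists g => //; apply: le_trans (ler_norm g) _; apply: (le_trans gb).
by rewrite mulrC ler_pM2r// invr_gt0 exprn_gt0.
Qed.

End clt_bounds.

(** * The central limit theorem with general norming constants *)

Section walk_clt.
Context {K : realType} {disp} {T : measurableType disp} (P : probability T K).
Context (R : {RV P >-> K}) (Rs : nat -> {RV P >-> K}).
Context (U : forall d : nat, nat -> {RV P >-> 'rV[K]_d}) (n : nat -> nat) (m4 : K).
Hypothesis Rs_law : forall i, same_law (Rs i) R.
Hypothesis Rs_indep : independent_RVs Rs.
Hypothesis U_unif : forall d, (0 < d)%N ->
  forall i, uniform_on_sphere (distribution P (U d i)).
Hypothesis U_indep : forall d, (0 < d)%N -> independent_RVs (U d).
Hypothesis RU_indep : forall d, (0 < d)%N -> independent_families Rs (U d).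
Hypothesis n_cvg : n @ \oo --> \oo.
Hypothesis R2 : mean P (fun w => R w ^+ 2) 1.
Hypothesis R4 : mean P (fun w => R w ^+ 4) m4.

Let V := m4 - 1.

Let Y2 : mean P (fun w => (R w ^+ 2 - 1) ^+ 2) V.
Proof.
rewrite (_ : V = m4 - 2 * 1 + 1); last by rewrite /V; ring.
by apply: mean_ext (meanD (meanB R4 (meanZ 2 R2)) (mean_cst P 1)) => w; ring.
Qed.

Let V0 : 0 <= V. Proof. by apply: (mean_ge0 _ Y2) => w; exact: sqr_ge0. Qed.

Let mY : measurable_fun setT (fun w => R w ^+ 2 - 1).
Proof. by apply: measurable_funB => //; exact: measurable_funX. Qed.

Let n_large A : \forall d \near \oo, A <= (n d)%:R :> K.
Proof. by move: A; apply/cvgryPge; apply/cvgrnyP. Qed.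

Let d_large A : \forall d \near \oo, A <= d%:R :> K.
Proof. by move: A; apply/cvgryPge; exact: cvgr_idn. Qed.

Variables (c : nat -> K) (s2 : K).
Hypothesis c_gt0 : \forall d \near \oo, 0 < c d.
Hypothesis s20 : 0 < s2.
Hypothesis total_var :
  ((n d)%:R * V + 2 * (n d)%:R ^+ 2 / d%:R) / c d ^+ 2 @[d --> \oo] --> s2.

Let Lam0 := s2 + 1.

Let total_var_le : \forall d \near \oo,
  (n d)%:R * V + 2 * (n d)%:R ^+ 2 / d%:R <= Lam0 * c d ^+ 2.
Proof.
near=> d; have c0 : 0 < c d by near: d.
rewrite -ler_pdivrMr ?exprn_gt0//; near: d.
by apply: (cvgr_le _ total_var); rewrite /Lam0 ltrDl.
Unshelve. all: by end_near. Qed.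

(** If V = 0 the radial part vanishes almost surely; this case is separate because [c d] need not
    grow then. If V > 0, the bound n V <= Lam0 c^2 forces [c d] to infinity and turns o(1 / c^2)
    into o(1 / n). *)
Let radial_small e : 0 < e -> \forall d \near \oo, exists2 g,
  mean P (fun w => cut_cube ((R w ^+ 2 - 1) / c d)) g & (n d)%:R * g <= e.
Proof.
move=> e0; have [V_0|Vn0] := eqVneq V 0.
  apply: nearW => d; exists 0; last by rewrite mulr0 ltW.
  have Y20 : mean P (fun w => (R w ^+ 2 - 1) ^+ 2) 0 by rewrite -V_0.
  apply: ae_mean (mean_cst P 0).
    apply: (measurableT_comp measurable_cut_cube); exact: measurable_funM.
  apply: filterS (mean0_ae (fun w => sqr_ge0 _) Y20) => w /eqP.
  rewrite sqrf_eq0 => /eqP ->.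
  by rewrite mul0r /cut_cube normr0 !expr0n /= minxx.
have Vp : 0 < V by rewrite lt_def Vn0.
have L0 : 0 < Lam0 by rewrite /Lam0 addr_gt0.
have eta0 : 0 < e * V / Lam0 by rewrite divr_gt0// mulr_gt0.
have [k k0 hk] := cut_cube_mean mY Y2 eta0.
near=> d.
have c0 : 0 < c d by near: d.
have hL : (n d)%:R * V + 2 * (n d)%:R ^+ 2 / d%:R <= Lam0 * c d ^+ 2 by near: d.
have nL : (n d)%:R * V <= Lam0 * c d ^+ 2.
  by apply: le_trans hL; rewrite lerDl divr_ge0// mulr_ge0// exprn_ge0.
have kn : k ^+ 2 * Lam0 / V <= (n d)%:R by near: d; exact: n_large.
have kc : k <= c d.
  rewrite ler_pdivrMr// in kn.
  rewrite -(@ler_pXn2r _ 2)//; last 2 first.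
  - by rewrite nnegrE ltW.
  - by rewrite nnegrE ltW.
  by rewrite -(ler_pM2r L0) [leRHS]mulrC; exact: le_trans kn nL.
have [g hg gb] := hk _ kc; exists g => //.
have c2 : 0 < c d ^+ 2 by rewrite exprn_gt0.
apply: (@le_trans _ _ ((n d)%:R * (e * V / Lam0 / c d ^+ 2))).
  by apply: ler_wpM2l.
rewrite (_ : _ * _ = e * ((n d)%:R * V / (Lam0 * c d ^+ 2))).
  apply: ler_piMr; first exact: ltW.
  by rewrite ler_pdivrMr ?mul1r// mulr_gt0.
by field; rewrite !gt_eqF.
Unshelve. all: by end_near. Qed.

Let X d w := (enorm (walk Rs (U d) (n d) w) ^+ 2 - (n d)%:R) / c d.

(** [sqnorm_var] lives in dimension [d'.+1], hence the predecessor; d = 0 is discarded as d tends to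
    infinity. *)
Let var d := @sqnorm_var K d.-1 m4 (n d) / c d ^+ 2.

Let XE d' w : X d'.+1 w = (sqnorm Rs (U d'.+1) (n d'.+1) w - (n d'.+1)%:R) / c d'.+1.
Proof. by rewrite /X enorm_sqr. Qed.

Let X_mean d : (0 < d)%N -> 0 < c d -> measurable_fun setT (X d) /\
  mean P (fun w => X d w ^+ 2) (var d).
Proof.
case: d => // d' d0 c0; have uU := U_unif d0.
have hm := sqnorm_variance Rs_indep (U_indep d0) (RU_indep d0) uU Rs_law R2 R4
  (n d'.+1).
split.
  rewrite (_ : X _ = fun w => (sqnorm Rs (U d'.+1) (n d'.+1) w - (n d'.+1)%:R)
    / c d'.+1); last by apply/funext => w; rewrite XE.
  apply: measurable_funM => //; apply: measurable_funB => //.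
  exact: measurable_sqnorm.
rewrite /var /= mulrC; apply: mean_ext (meanZ (c d'.+1 ^+ 2)^-1 hm) => w.
by rewrite XE expr_div_n mulrC.
Qed.

(** The exact variance has n (n - 1) where [total_var] has n^2; after norming, the difference is at
    most Lam0 / n. *)
Let var_cvg : var @ \oo --> s2.
Proof.
apply/cvgrPdist_le => e e0.
have L0 : 0 < Lam0 by rewrite /Lam0 addr_gt0.
near=> d.
have d0 : (0 < d)%N by near: d; exact: nbhs_infty_gt.
have c0 : 0 < c d by near: d.
have hL : (n d)%:R * V + 2 * (n d)%:R ^+ 2 / d%:R <= Lam0 * c d ^+ 2 by near: d.
have D0 : 0 < d%:R :> K by rewrite ltr0n.
have Nbig : 2 * Lam0 / e + 1 <= (n d)%:R by near: d; exact: n_large.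
have N0 : 0 < (n d)%:R :> K.
  by apply: lt_le_trans Nbig; rewrite ltr_wpDl// divr_ge0 ?mulr_ge0// ltW.
have h1 : `|s2 - ((n d)%:R * V + 2 * (n d)%:R ^+ 2 / d%:R) / c d ^+ 2| <= e / 2.
  by near: d; move/cvgrPdist_le : total_var; apply; rewrite divr_gt0.
have [DN cN NN] : [/\ d%:R != 0 :> K, c d != 0 & (n d)%:R != 0 :> K].
  by split; rewrite gt_eqF.
have varE : var d = ((n d)%:R * V + 2 * (n d)%:R ^+ 2 / d%:R) / c d ^+ 2
    - 2 * (n d)%:R / d%:R / c d ^+ 2.
  rewrite /var /sqnorm_var prednK// /V; field.
  by rewrite DN cN.
have c2 : 0 < c d ^+ 2 by rewrite exprn_gt0.
have h2 : 2 * (n d)%:R / d%:R / c d ^+ 2 <= Lam0 / (n d)%:R.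
  rewrite ler_pdivrMr// [leRHS]mulrAC ler_pdivlMr//.
  apply: le_trans hL; rewrite (_ : 2 * (n d)%:R / d%:R * (n d)%:R = 2 * (n d)%:R ^+ 2 / d%:R).
    by rewrite lerDr mulr_ge0// ltW.
  by field.
have h20 : 0 <= 2 * (n d)%:R / d%:R / c d ^+ 2.
  by rewrite !divr_ge0 ?mulr_ge0 ?ltW.
have h3 : Lam0 / (n d)%:R <= e / 2.
  rewrite ler_pdivrMr// -ler_pdivrMl ?divr_gt0//.
  apply: le_trans Nbig; rewrite (_ : (e / 2)^-1 * Lam0 = 2 * Lam0 / e).
    by rewrite lerDl.
  by field; rewrite gt_eqF.
rewrite varE (_ : s2 - _ = (s2 - ((n d)%:R * V + 2 * (n d)%:R ^+ 2 / d%:R) / c d ^+ 2)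
  + 2 * (n d)%:R / d%:R / c d ^+ 2); last by ring.
apply: le_trans (ler_normD _ _) _; rewrite (ger0_norm h20); lra.
Unshelve. all: by end_near. Qed.

Lemma walk_clt : cvg_in_distribution P X (centered_normal s2).
Proof.
have L0 : 0 < Lam0 by rewrite /Lam0 addr_gt0.
apply: (@weak_cvg_heat _ _ _ P X var) => //.
  near=> d; apply: X_mean; first by near: d; exact: nbhs_infty_gt.
  by near: d.
move=> tau e tau0 e0.
have [C hC] := heat_const_exists tau0.
have C0 : 0 < C by case: hC.
(* [step_bound_le] leaves four groups of errors, each allotted e / (4 C), where C is the factor in
   [heat_walk]. [eta] uses half of the first share and [eps] all of the third. *)
pose e5 := e / (4 * C).
have e50 : 0 < e5 by rewrite divr_gt0// mulr_gt0.
pose eta := e5 / (2 * (1 + Lam0)).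
have eta0 : 0 < eta by rewrite divr_gt0// mulr_gt0//; lra.
pose eps := e5 / (8 * Lam0).
have eps0 : 0 < eps by rewrite divr_gt0// mulr_gt0.
have m40 : 0 <= m4 by have := V0; rewrite /V; lra.
have e58 : 0 < e5 / 8 by rewrite divr_gt0.
have key d : (0 < d)%N -> 0 < c d ->
    (n d)%:R * V + 2 * (n d)%:R ^+ 2 / d%:R <= Lam0 * c d ^+ 2 ->
    2 * (1 + Lam0) * Lam0 / (eta * e5) <= d%:R ->
    0 < (n d)%:R :> K ->
    (192 * m4 / eps * Lam0 ^+ 2 + 9 * Lam0 ^+ 2) / e5 <= (n d)%:R ->
    (exists2 g, mean P (fun w => cut_cube ((R w ^+ 2 - 1) / c d)) g &
      (n d)%:R * g <= e5 / 8) ->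
    forall m, exists2 q, mean P (fun w => heat tau (X d w - m)) q &
      `|q - heat (tau + var d) (- m)| <= e.
  case: d => // d' d0 c0 hL hd N0 hN [g hg gb] m.
  have uU := U_unif d0; have D1 : 1 <= d'.+1%:R :> K by rewrite ler1n.
  have [q hq qb] := heat_walk Rs_indep (U_indep d0) (RU_indep d0) uU Rs_law R2 R4
    hC c0 eps0 hg (erefl (d'.+1%:R : K)) (n d'.+1) m.
  exists q; first by apply: mean_ext hq => w; rewrite XE.
  rewrite /var /=; apply: (le_trans qb).
  have D0 : 0 < d'.+1%:R :> K by [].
  have sig0 : 0 <= @sqnorm_var K d' m4 (n d'.+1).
    have h := sqnorm_variance Rs_indep (U_indep d0) (RU_indep d0) uU Rs_law R2 R4
      (n d'.+1).
    by apply: (mean_ge0 _ h) => w; exact: sqr_ge0.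
  have sigL : @sqnorm_var K d' m4 (n d'.+1) <= Lam0 * c d'.+1 ^+ 2.
    apply: le_trans hL; rewrite /sqnorm_var -/V lerD2l ler_pM2r ?invr_gt0//.
    rewrite -mulrA ler_pM2l// expr2 ler_pM2l//; lra.
  have hb := step_bound_le g N0 D1 c0 V0 eps0 eta0 sig0 m40 hL sigL.
  rewrite mulrCA -ler_pdivlMl//; apply: (le_trans hb).
  have -> : C^-1 * e = 4 * e5 by rewrite /e5; field; rewrite gt_eqF.
  have u1 : (1 + Lam0) * (eta + Lam0 / (d'.+1%:R * eta)) <= e5.
    have h1 : (1 + Lam0) * eta = e5 / 2.
      by rewrite /eta; field; rewrite gt_eqF//; lra.
    have h2 : (1 + Lam0) * (Lam0 / (d'.+1%:R * eta)) <= e5 / 2.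
      rewrite mulrA (ler_pdivrMr _ _ (mulr_gt0 D0 eta0)).
      rewrite (ler_pdivrMr _ _ (mulr_gt0 eta0 e50)) in hd.
      rewrite mulrAC ler_pdivlMr// (_ : _ * 2 = 2 * (1 + Lam0) * Lam0); last by ring.
      by rewrite (_ : e5 * _ = d'.+1%:R * (eta * e5)); last by ring.
    by rewrite mulrDr h1 [leRHS]splitr lerD2l.
  have u2 : 8 * eps * Lam0 = e5 by rewrite /eps; field; rewrite gt_eqF.
  have u3 : (192 * m4 / eps * Lam0 ^+ 2 + 9 * Lam0 ^+ 2) / (n d'.+1)%:R <= e5.
    by rewrite ler_pdivrMr// [leRHS]mulrC -(ler_pdivrMr _ _ e50).
  rewrite u2 (_ : 4 * e5 = e5 + e5 + e5 + e5); last by ring.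
  by rewrite !lerD// mulrC -ler_pdivlMr.
near=> d; apply: key.
- by near: d; exact: nbhs_infty_gt.
- by near: d.
- by near: d.
- by near: d; exact: d_large.
- by apply: (@lt_le_trans _ _ 1) => //; near: d; exact: n_large.
- by near: d; exact: n_large.
- by near: d; exact: radial_small.
Unshelve. all: by end_near. Qed.

End walk_clt.

(** * Moments of the radius and determinism *)

Section radius_moments.
Context {K : realType} {disp} {T : measurableType disp} (P : probability T K).
Context (R : {RV P >-> K}).

Lemma expectation_mean (f : T -> K) : measurable_fun setT f ->
  (forall w, 0 <= f w) -> ('E_P[f] < +oo)%E -> mean P f (fine 'E_P[f]).
Proof.
move=> mf f0 Ef; rewrite unlock in Ef *.
apply: ge0_mean => //; rewrite fineK// ge0_fin_numE//.
by apply: integral_ge0 => w _; rewrite lee_fin.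
Qed.

Lemma mean_expectation (f : T -> K) a : mean P f a -> ('E_P[f] = a%:E)%E.
Proof. by rewrite unlock => -[]. Qed.

Lemma variance_mean (f : T -> K) a b : mean P f a ->
  mean P (fun w => f w ^+ 2) b -> variance P f = (b - a ^+ 2)%:E.
Proof.
move=> fa fb; rewrite /variance unlock (mean_expectation fa) /=.
apply: mean_expectation.
rewrite (_ : b - a ^+ 2 = b - 2 * a * a + a ^+ 2); last by ring.
apply: mean_ext (meanD (meanB fb (meanZ (2 * a) fa)) (mean_cst P (a ^+ 2))) => w.
by rewrite -[RHS]/((f w - a) * (f w - a)); ring.
Qed.

Lemma deterministic_fourth_moment m4 : mean P (fun w => R w ^+ 2) 1 ->
  mean P (fun w => R w ^+ 4) m4 -> deterministic R -> m4 = 1.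
Proof.
move=> R2 R4 [k Rk].
have k2 : k ^+ 2 = 1.
  apply: mean_uniq R2; apply: ae_mean (mean_cst P _).
    exact: measurable_funX.
  by apply: filterS Rk => w ->.
apply: (mean_uniq R4); apply: ae_mean (mean_cst P _).
  exact: measurable_funX.
by apply: filterS Rk => w ->; rewrite (exprM k 2 2) k2 expr1n.
Qed.

(** Equality in E R^4 >= (E R^2)^2 forces R^2 = 1 almost surely. By contraposition, V > 0 for a
    radius that is not deterministic. *)
Lemma fourth_moment_deterministic : {ae P, forall w, 0 <= R w} ->
  mean P (fun w => R w ^+ 2) 1 -> mean P (fun w => R w ^+ 4) 1 ->
  deterministic R.
Proof.
move=> R0 R2 R4; exists 1.
have Y20 : mean P (fun w => (R w ^+ 2 - 1) ^+ 2) 0.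
  rewrite (_ : 0 = 1 - 2 * 1 + 1 :> K); last by ring.
  by apply: mean_ext (meanD (meanB R4 (meanZ 2 R2)) (mean_cst P 1)) => w; ring.
apply: filterS2 R0 (mean0_ae (fun w => sqr_ge0 _) Y20) => w Rw /eqP.
rewrite sqrf_eq0 subr_eq0 => /eqP Rw1.
by apply/eqP; rewrite -(@eqrXn2 _ 2)// Rw1 expr1n.
Qed.

Lemma fourth_moment_ge1 m4 : mean P (fun w => R w ^+ 2) 1 ->
  mean P (fun w => R w ^+ 4) m4 -> 1 <= m4.
Proof.
move=> R2 R4; rewrite -subr_ge0.
have Y2 : mean P (fun w => (R w ^+ 2 - 1) ^+ 2) (m4 - 1).
  rewrite (_ : m4 - 1 = m4 - 2 * 1 + 1); last by ring.
  by apply: mean_ext (meanD (meanB R4 (meanZ 2 R2)) (mean_cst P 1)) => w; ring.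
by apply: mean_ge0 Y2 => w; exact: sqr_ge0.
Qed.

End radius_moments.

Theorem theorem3p3 (K : realType) (disp : measure_display)
    (T : measurableType disp) (P : probability T K)
    (R : {RV P >-> K}) (Rs : nat -> {RV P >-> K})
    (U : forall d : nat, nat -> {RV P >-> 'rV[K]_d}) (n : nat -> nat)
    (R_ge0 : {ae P, forall w, 0 <= R w})
    (ER2 : ('E_P[fun w => (R w ^+ 2)%R] = 1)%E)
    (ER4 : ('E_P[fun w => (R w ^+ 4)%R] < +oo)%E)
    (Rs_law : forall i, same_law (Rs i) R)
    (Rs_indep : independent_RVs Rs)
    (U_unif : forall d, (0 < d)%N ->
       forall i, uniform_on_sphere (distribution P (U d i)))
    (U_law : forall d, (0 < d)%N -> forall i j, same_law (U d i) (U d j))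
    (U_indep : forall d, (0 < d)%N -> independent_RVs (U d))
    (RU_indep : forall d, (0 < d)%N -> independent_families Rs (U d))
    (n_gt0 : forall d, (0 < d)%N -> (0 < n d)%N)
    (n_cvg : n @ \oo --> \oo) :
  let S := fun d => walk Rs (U d) in
  let VarR2 : K := fine (variance P (fun w => R w ^+ 2)) in
  [/\ (n d)%:R / d%:R @[d --> \oo] --> (0 : K) -> ~ deterministic R ->
      cvg_in_distribution P
        (fun d w => (enorm (S d (n d) w) ^+ 2 - (n d)%:R) / Num.sqrt (n d)%:R)
        (centered_normal VarR2),
      ((n d)%:R / d%:R : K) @[d --> \oo] --> +oo \/ deterministic R ->
      cvg_in_distribution P
        (fun d w => (enorm (S d (n d) w) ^+ 2 - (n d)%:R)
                    / Num.sqrt (2 * (n d)%:R ^+ 2 / d%:R))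
        (centered_normal 1)
    & forall gamma : K, 0 < gamma ->
      (n d)%:R / d%:R @[d --> \oo] --> gamma ->
      cvg_in_distribution P
        (fun d w => (enorm (S d (n d) w) ^+ 2 - (n d)%:R) / Num.sqrt (n d)%:R)
        (centered_normal (2 * gamma + VarR2))].
Proof.
move=> S VarR2.
have R2 : mean P (fun w => R w ^+ 2) 1.
  rewrite -[1]/(fine 1%E) -ER2; apply: expectation_mean => //.
  - exact: measurable_funX.
  - by move=> w; exact: sqr_ge0.
  - by rewrite ER2 ltry.
have [m4 R4] : exists m4, mean P (fun w => R w ^+ 4) m4.
  exists (fine 'E_P[fun w => R w ^+ 4]); apply: expectation_mean => //.
  - exact: measurable_funX.
  - by move=> w; exact: exprn_even_ge0.
have VE : VarR2 = m4 - 1.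
  have R22 : mean P (fun w => (R w ^+ 2) ^+ 2) m4.
    by apply: mean_ext R4 => w; rewrite -exprM.
  by rewrite /VarR2 (variance_mean R2 R22) expr1n.
have V0 : 0 <= m4 - 1 by rewrite subr_ge0; exact: fourth_moment_ge1 R2 R4.
have clt := walk_clt Rs_law Rs_indep U_unif U_indep RU_indep n_cvg R2 R4.
have n0 : \forall d \near \oo, 0 < (n d)%:R :> K.
  near=> d; rewrite ltr0n; apply: n_gt0.
  by near: d; exact: nbhs_infty_gt.
have d0 : \forall d \near \oo, 0 < d%:R :> K.
  by near=> d; rewrite ltr0n; near: d; exact: nbhs_infty_gt.
(* Parts (a) and (c) together: gamma = 0 is allowed as long as the limit variance is positive. *)
have sqrt_norming gamma : 0 < 2 * gamma + (m4 - 1) ->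
    (n d)%:R / d%:R @[d --> \oo] --> gamma ->
    cvg_in_distribution P
      (fun d w => (enorm (S d (n d) w) ^+ 2 - (n d)%:R) / Num.sqrt (n d)%:R)
      (centered_normal (2 * gamma + (m4 - 1))).
  move=> s20 nd; apply: clt => //.
    by near=> d; rewrite sqrtr_gt0; near: d.
  have lim : 2 * ((n d)%:R / d%:R) + (m4 - 1) @[d --> \oo] --> 2 * gamma + (m4 - 1).
    by apply: cvgD; [exact: cvgMr|exact: cvg_cst].
  apply: cvg_trans lim; apply: near_eq_cvg; near=> d.
  have N0 : 0 < (n d)%:R :> K by near: d.
  have D0 : 0 < d%:R :> K by near: d.
  by rewrite sqr_sqrtr ?ltW//; field; rewrite !gt_eqF.
split.
- move=> nd ndet; rewrite VE.
  have -> : m4 - 1 = 2 * 0 + (m4 - 1) by rewrite mulr0 add0r.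
  apply: sqrt_norming nd; rewrite mulr0 add0r lt_def V0 andbT subr_eq0.
  apply/eqP => m41; apply: ndet; apply: fourth_moment_deterministic => //.
  by rewrite -m41.
- move=> h; apply: clt => //.
    near=> d; rewrite sqrtr_gt0 divr_gt0//; last by near: d.
    by rewrite mulr_gt0// exprn_gt0//; near: d.
  (* The ratio of n V + 2 n^2 / d to 2 n^2 / d is 1 + (V / 2) (d / n). The second term vanishes in
     the limit if n / d tends to infinity, and identically if V = 0. *)
  have lim : 1 + (m4 - 1) / 2 * ((n d)%:R / d%:R)^-1 @[d --> \oo] --> (1 : K).
    rewrite -[X in _ --> X]addr0; apply: cvgD; first exact: cvg_cst.
    case: h => [nd|det]; last first.
      rewrite (deterministic_fourth_moment R2 R4 det) subrr mul0r.
      rewrite (_ : (fun _ => _) = cst 0); last by apply/funext => d; rewrite mul0r.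
      exact: cvg_cst.
    rewrite -(mulr0 ((m4 - 1) / 2)); apply: cvgMr.
    apply: (@gtr0_cvgV0 K nat \oo _ (fun d => (n d)%:R / d%:R) _).2 => //.
    by near=> d; rewrite divr_gt0//; near: d.
  apply: cvg_trans lim; apply: near_eq_cvg; near=> d.
  have N0 : 0 < (n d)%:R :> K by near: d.
  have D0 : 0 < d%:R :> K by near: d.
  rewrite sqr_sqrtr; last by rewrite divr_ge0 ?mulr_ge0 ?sqr_ge0 ?ltW.
  by field; rewrite !gt_eqF.
- move=> gamma g0 nd; rewrite VE; apply: sqrt_norming nd.
  by apply: ltr_wpDr => //; rewrite mulr_gt0.
Unshelve. all: by end_near. Qed.
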